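(* For all $d\in\mathbb{N}$ and all $\varepsilon\in(0,1)$, \[ N^{\mathrm{cap}}(\varepsilon,d) \le \left\lceil \frac{1}{\varepsilon^2}\,\frac{1}{\sqrt{\pi d}-1}\right\rceil. \]
   Context: $\mathbb{S}^d=\{\bm{x}\in\mathbb{R}^{d+1}:\|\bm{x}\|_2=1\}$ with the surface measure $\sigma_d$ normalized so that $\sigma_d(\mathbb{S}^d)=1$. For $\bm{x}\in\mathbb{S}^d$ and $t\in[-1,1]$, $C(\bm{x};t)=\{\bm{y}\in\mathbb{S}^d:\langle\bm{x},\bm{y}\rangle\ge t\}$ is a spherical cap, with indicator function $\bm{1}_{C(\bm{x};t)}$. For an $N$-point set $P_{N,d}=\{\bm{x}_1,\dots,\bm{x}_N\}\subseteq\mathbb{S}^d$, the spherical cap $L_2$ discrepancy is \[ L_2^{\mathrm{cap}}(P_{N,d}) = \left(\int_{-1}^1\int_{\mathbb{S}^d}\Big(\frac1N\sum_{n=1}^N \bm{1}_{C(\bm{x};t)}(\bm{x}_n)-\sigma_d(C(\bm{x};t))\Big)^2\mathrm{d}\sigma_d(\bm{x})\,\mathrm{d}t\right)^{1/2}, \] and the initial discrepancy is $L_2^{\mathrm{cap}}(\emptyset)=\left(\int_{-1}^1\int_{\mathbb{S}^d}\sigma_d(C(\bm{x};t))^2\,\mathrm{d}\sigma_d(\bm{x})\,\mathrm{d}t\right)^{1/2}$. For $\varepsilon\in(0,1)$ the inverse discrepancy is $N^{\mathrm{cap}}(\varepsilon,d)=\inf\{N\in\mathbb{N}:\exists P_{N,d}\subseteq\mathbb{S}^d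 \text{ with } L_2^{\mathrm{cap}}(P_{N,d})\le\varepsilon L_2^{\mathrm{cap}}(\emptyset)\}$. *)

(* Defs.v *)
From HB Require Import structures.
From mathcomp Require Import all_boot all_order all_algebra.
From mathcomp Require Import all_classical all_reals all_analysis.
Set Implicit Arguments. Unset Strict Implicit. Unset Printing Implicit Defensive.
Import Order.TTheory GRing.Theory Num.Theory.
Local Open Scope classical_set_scope.
Local Open Scope ring_scope.

Section Sphere.
Variable R : realType.

Definition dotp n (x y : n.-tuple R) : R := \sum_(i < n) tnth x i * tnth y i.
Definition enorm n (x : n.-tuple R) : R := Num.sqrt (dotp x x).

Definition sphere d : set (d.+1.-tuple R) := [set x | enorm x = 1].

(* Iterated Lebesgue integral over R^n (Tonelli: equals the integral w.r.t.
   n-dimensional Lebesgue measure for nonnegative measurable integrands, which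
   is the only way it is used below). *)
Fixpoint IntRn (n : nat) : (n.-tuple R -> \bar R) -> \bar R :=
  match n return (n.-tuple R -> \bar R) -> \bar R with
  | 0 => fun g => g [tuple]
  | m.+1 => fun g =>
      (\int[@lebesgue_measure R]_t IntRn (fun y : m.-tuple R => g (cons_tuple t y)))%E
  end.

Definition in_cone n (y : n.-tuple R) : bool := (0 < enorm y) && (enorm y <= 1).

Definition ball_vol n : \bar R :=
  IntRn (fun y : n.-tuple R => ((enorm y <= 1)%R%:R)%:E).

(* Integral w.r.t. the normalized surface measure sigma_d on S^d, defined via
   the cone construction (Folland, Thm 2.49):
   int f dsigma_d = (1/lambda_{d+1}(B)) * int_{0<|y|<=1} f(y/|y|) dlambda_{d+1}(y). *)
Definition sph_int d (f : d.+1.-tuple R -> \bar R) : \bar R :=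
  (((fine (ball_vol d.+1))^-1)%:E *
   IntRn (fun y : d.+1.-tuple R =>
     if in_cone y then f [tuple of map (fun c : R => (c / enorm y)%R) y] else 0))%E.

(* Indicator 1_{C(x;t)}(y), C(x;t) = {y in S^d : <x,y> >= t}
   (only evaluated at points y of the sphere). *)
Definition cap_ind d (x : d.+1.-tuple R) (t : R) (y : d.+1.-tuple R) : R :=
  (t <= dotp x y)%R%:R.

Definition sigma_cap d (x : d.+1.-tuple R) (t : R) : R :=
  fine (sph_int (fun y => (cap_ind x t y)%:E)).

Definition L2cap d N (P : 'I_N -> d.+1.-tuple R) : R :=
  Num.sqrt (fine (\int[@lebesgue_measure R]_(t in `[(-1)%R, 1%R]%classic)
    sph_int (fun x =>
      (((N%:R)^-1 * \sum_(n < N) cap_ind x t (P n) - sigma_cap x t) ^+ 2)%:E))%E).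

Definition L2cap_init d : R :=
  Num.sqrt (fine (\int[@lebesgue_measure R]_(t in `[(-1)%R, 1%R]%classic)
    sph_int (fun x : d.+1.-tuple R => ((sigma_cap x t) ^+ 2)%:E))%E).

Definition point_set d N (P : 'I_N -> d.+1.-tuple R) : Prop :=
  injective P /\ (forall n : 'I_N, P n \in @sphere d).

Definition Ncap (eps : R) (d : nat) : \bar R :=
  ereal_inf [set (N%:R)%:E | N in [set N : nat | (0 < N)%N /\
     exists P : 'I_N -> d.+1.-tuple R,
       point_set P /\ L2cap P <= eps * L2cap_init d]].

End Sphere.

(* Main.v *)
(** Write V(t, x) for the normalized measure of the cap C(x; t), and
    c = int V (1 - V) dt dsigma(x).  If points are chosen one at a time, averaging
    over the next point increases the integral of the squared unnormalized
    discrepancy by exactly c, so some choice increases it by at most c; hence N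
    points with L_2^2 <= c / N.  Since int V = 1, the squared initial discrepancy
    is 1 - c, and it remains to see that c <= 1 / sqrt (pi d).  Integrating over t
    first, c = E <x, y - w>^+ with x, y, w independent and uniform on the sphere.
    Comparison with a Gaussian vector in polar coordinates gives
    E <x, v>^+ <= |v| / sqrt (2 pi d) for every v, and E |y - w| <= sqrt 2. *)

Require Import Defs.
From HB Require Import structures.
From mathcomp Require Import all_boot all_order all_algebra.
From mathcomp Require Import all_classical all_reals all_analysis.
From mathcomp Require Import measurable_realfun ring lra.
Import Order.TTheory GRing.Theory Num.Theory.
Import numFieldNormedType.Exports.
Local Open Scope classical_set_scope.
Local Open Scope ring_scope.
Set Implicit Arguments.
Unset Strict Implicit.

(** Polar coordinates enter without disintegrating Lebesgue measure. By definition [sph_int]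
    averages a function of degree 0 over the unit ball, and behaviour under dilations alone supplies
    two links: the Gaussian integral of a homogeneous function is a half-line moment times its ball
    integral, and the ball integrals of [f y] and [|y| f y], for [f] of degree 0, differ by an
    explicit factor. The exact mean of [<x, v>^+] is a quotient of Gamma values. Half-line Gaussian
    moments stand for them; an AM-GM bound on consecutive moments together with
    [d (d + 2) <= (d + 1)^2] produces the constant [sqrt (2 pi d)]. Integrands are kept nonnegative
    (positive parts, a hit times a miss), so that every exchange of integrals is Tonelli's theorem.
    A point set must consist of distinct points. The greedy choice therefore has to avoid the points
    already taken, which are null because [d >= 1]. The final constant is [c / (1 - c)] at
    [c = 1 / sqrt (pi d)], that is [1 / (sqrt (pi d) - 1)]. *)

Section ImageMeasure.
Local Open Scope ereal_scope.
Context d1 d2 (T1 : measurableType d1) (T2 : measurableType d2) (R : realType).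
Variables (m : {measure set T1 -> \bar R}) (f : T1 -> T2).
Variable mf : measurable_fun setT f.

(* Unlike [pushforward], carries the measurability proof, so that the measure
   structure can be inferred. *)
Definition mimage of measurable_fun setT f : set T2 -> \bar R := pushforward m f.

Let mimage0 : mimage mf set0 = 0. Proof. exact: measure0. Qed.

Let mimage_ge0 A : 0 <= mimage mf A. Proof. exact: measure_ge0. Qed.

Let mimage_sigma_additive : semi_sigma_additive (mimage mf).
Proof. exact: measure_semi_sigma_additive. Qed.

HB.instance Definition _ := isMeasure.Build _ _ _ (mimage mf)
  mimage0 mimage_ge0 mimage_sigma_additive.

Lemma ge0_integral_mimage (g : T2 -> \bar R) :
  measurable_fun setT g -> (forall y, 0 <= g y) ->
  \int[mimage mf]_y g y = \int[m]_x g (f x).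
Proof. by move=> mg g0; rewrite [LHS]ge0_integral_pushforward. Qed.

End ImageMeasure.

Section Tonelli.
Local Open Scope ereal_scope.
Context d1 d2 (T1 : measurableType d1) (T2 : measurableType d2) (R : realType).
Variables (m1 : {sigma_finite_measure set T1 -> \bar R}).
Variables (m2 : {sigma_finite_measure set T2 -> \bar R}).
Variable F : T1 -> T2 -> \bar R.
Hypothesis mF : measurable_fun setT (fun p : T1 * T2 => F p.1 p.2).
Hypothesis F0 : forall x y, 0 <= F x y.

Lemma measurable_ge0_integral :
  measurable_fun setT (fun x => \int[m2]_y F x y).
Proof. by apply: measurable_fun_fubini_tonelli_F mF _ => -[]. Qed.

Lemma tonelli : \int[m1]_x \int[m2]_y F x y = \int[m2]_y \int[m1]_x F x y.
Proof. by apply: fubini_tonelli mF _ => -[]. Qed.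

End Tonelli.

Section AffineSubstitution.
Context {R : realType}.
Local Notation leb := (@lebesgue_measure R).
Implicit Types a b : R.

Lemma measurable_affine a b :
  measurable_fun [set: measurableTypeR R] (fun t : R => a * t + b : measurableTypeR R).
Proof. by apply: measurable_funD => //; apply: measurable_funM. Qed.

(** By uniqueness of Lebesgue measure it is enough to compare half-open intervals. A negative slope
    moves the closed end to the other side, which does not change the length. *)
Lemma lebesgue_measure_affine a b (A : set R) : a != 0 -> measurable A ->
  (leb A = `|a|%:E * mimage leb (measurable_affine a b) A)%E.
Proof.
move=> a0 mA; rewrite -[RHS]/(mscale (NngNum (normr_ge0 a))
  (mimage leb (measurable_affine a b)) A).
apply: lebesgue_measure_unique => //= _ [[x y]] /= _ <-.
rewrite /mscale/= /mimage /pushforward.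
have [a_gt0|a_le0] := ltP 0 a.
  have -> : (fun t => a * t + b) @^-1` `]x, y]%classic =
      `](x - b) / a, (y - b) / a]%classic.
    apply/seteqP; split => t /=; rewrite !in_itv/= ltr_pdivrMr// ler_pdivlMr//;
    by rewrite ltrBlDr lerBrDr mulrC.
  rewrite !lebesgue_measure_itv/= !lte_fin ltr_pM2r ?invr_gt0// ltrD2r.
  case: ifPn => _; last by rewrite mule0.
  by rewrite gtr0_norm// -!EFinD -EFinM; congr EFin; field.
have a_lt0 : a < 0 by rewrite lt_neqAle a0.
have -> : (fun t => a * t + b) @^-1` `]x, y]%classic =
    `[(y - b) / a, (x - b) / a[%classic.
  apply/seteqP; split => t /=; rewrite !in_itv/= ltr_ndivlMr// ler_ndivrMr//;
  by rewrite ltrBlDr lerBrDr mulrC andbC.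
rewrite !lebesgue_measure_itv/= !lte_fin ltr_nM2r ?invr_lt0// ltrD2r.
case: ifPn => _; last by rewrite mule0.
by rewrite ltr0_norm// -!EFinD -EFinM; congr EFin; field.
Qed.

Lemma ge0_integral_affine a b (g : R -> \bar R) : a != 0 ->
  measurable_fun setT g -> (forall t, 0 <= g t)%E ->
  (\int[leb]_t g t = `|a|%:E * \int[leb]_t g (a * t + b)%R)%E.
Proof.
move=> a0 mg g0; rewrite (eq_measure_integral (mscale (NngNum (normr_ge0 a))
  (mimage leb (measurable_affine a b)))); last first.
  by move=> A mA _; exact: lebesgue_measure_affine.
by rewrite ge0_integral_mscale// ge0_integral_mimage.
Qed.
End AffineSubstitution.

Section SigmaFiniteProduct.
Local Open Scope ereal_scope.
Context d1 d2 (T1 : measurableType d1) (T2 : measurableType d2) (R : realType).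
Variables (m1 : {sigma_finite_measure set T1 -> \bar R}).
Variables (m2 : {sigma_finite_measure set T2 -> \bar R}).

(* A copy of [m1 \x m2]: on the original, the sigma-finite structure is shadowed
   by the one for products of subprobabilities. *)
Definition sfprod : set (T1 * T2) -> \bar R := m1 \x m2.

HB.instance Definition _ := Measure.on sfprod.

Let sfprod_sigma_finite : sigma_finite setT sfprod.
Proof.
have /sigma_finiteP[F [TF ndF Foo]] := sigma_finiteT m1.
have /sigma_finiteP[G [TG ndG Goo]] := sigma_finiteT m2.
exists (fun k => F k `*` G k).
  apply/esym; rewrite -subTset => -[x y] _.
  have [i _ Fi] : (\bigcup_i F i) x by rewrite -TF.
  have [j _ Gj] : (\bigcup_i G i) y by rewrite -TG.
  exists (maxn i j) => //; split.
    by move: Fi; exact/subsetPset/ndF/leq_maxl.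
  by move: Gj; exact/subsetPset/ndG/leq_maxr.
move=> k; have [[mF Fk] [mG Gk]] := (Foo k, Goo k); split.
  exact: measurableX.
rewrite [ltLHS](@product_measure1E _ _ _ _ _ m1 m2)//.
by rewrite lte_mul_pinfty// ge0_fin_numE.
Qed.

HB.instance Definition _ := Measure_isSigmaFinite.Build _ _ _ sfprod sfprod_sigma_finite.

Lemma ge0_integral_sfprod (g : T1 * T2 -> \bar R) :
  measurable_fun setT g -> (forall p, 0 <= g p) ->
  \int[sfprod]_p g p = \int[m1]_x \int[m2]_y g (x, y).
Proof. exact: fubini_tonelli1. Qed.

End SigmaFiniteProduct.

(** * Lebesgue measure on tuples *)

Section TupleMeasure.
Context {R : realType}.
Local Notation leb := (@lebesgue_measure R).

Definition tcons n (p : measurableTypeR R * n.-tuple R) : n.+1.-tuple R :=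
  cons_tuple p.1 p.2.

Lemma measurable_tcons n : measurable_fun setT (@tcons n).
Proof. by apply: measurable_cons. Qed.

Lemma measurable_cons_tuple d (T : measurableType d) n (f : T -> R) (g : T -> n.-tuple R) :
  measurable_fun setT f -> measurable_fun setT g ->
  measurable_fun setT (fun x => cons_tuple (f x) (g x)).
Proof. by move=> mf mg; apply: measurable_cons. Qed.

Section Step.
Variables (n : nat) (m : {sigma_finite_measure set (n.-tuple R) -> \bar R}).

Definition mcons : set (n.+1.-tuple R) -> \bar R :=
  mimage (sfprod leb m) (@measurable_tcons n).

HB.instance Definition _ := Measure.on mcons.

Let mcons_sigma_finite : sigma_finite setT mcons.
Proof.
have [F TF Foo] := sigma_finiteT (sfprod leb m).
(* [u] is a left inverse of [tcons], so the preimages under [u] of an exhausting sequence keep their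
   measure. *)
pose u (y : n.+1.-tuple R) : measurableTypeR R * n.-tuple R :=
  (thead y, [tuple of behead y]).
have mu : measurable_fun setT u.
  apply/measurable_fun_pairP; split => /=.
    exact: (@measurable_tnth _ _ _ ord0).
  exact: measurable_behead.
have tK p : u (tcons p) = p.
  by case: p => t y; rewrite /u /tcons theadE; congr pair; exact: val_inj.
exists (fun k => u @^-1` F k).
  by rewrite -preimage_bigcup -TF preimage_setT.
move=> k; have [mF Fk] := Foo k; split.
  by rewrite -[X in measurable X]setTI; exact: mu.
rewrite /mcons /mimage /pushforward -comp_preimage.
by rewrite (_ : u \o @tcons n = id) ?preimage_id//; exact/funext.
Qed.

HB.instance Definition _ := Measure_isSigmaFinite.Build _ _ _ mcons mcons_sigma_finite.

Lemma ge0_integral_mcons (g : n.+1.-tuple R -> \bar R) :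
  measurable_fun setT g -> (forall y, 0 <= g y)%E ->
  (\int[mcons]_y g y = \int[leb]_t \int[m]_y g (cons_tuple t y))%E.
Proof.
move=> mg g0; rewrite ge0_integral_mimage// ge0_integral_sfprod//.
by apply: measurableT_comp => //; exact: measurable_tcons.
Qed.

End Step.

(** Lebesgue measure on [R^n], built one coordinate at a time so that its integral unfolds in the
    same way as [IntRn]. The base case is the unit mass at the empty tuple. *)
Fixpoint mtuple n : {sigma_finite_measure set (n.-tuple R) -> \bar R} :=
  match n with
  | 0 => \d_([tuple] : 0.-tuple R)
  | n.+1 => mcons (mtuple n)
  end.

Lemma ge0_integral_mtuple0 (g : 0.-tuple R -> \bar R) :
  measurable_fun setT g -> (\int[mtuple 0]_y g y = g [tuple])%E.
Proof.
by move=> mg; rewrite integral_dirac// diracE in_setT mul1e.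
Qed.

Lemma ge0_integral_mtupleS n (g : n.+1.-tuple R -> \bar R) :
  measurable_fun setT g -> (forall y, 0 <= g y)%E ->
  (\int[mtuple n.+1]_y g y = \int[leb]_t \int[mtuple n]_y g (cons_tuple t y))%E.
Proof. exact: ge0_integral_mcons. Qed.

(** Bridge from the iterated integrals of the definitions to integrals against one measure, for
    which Tonelli and changes of variables are available. *)
Lemma IntRnE n (g : n.-tuple R -> \bar R) :
  measurable_fun setT g -> (forall y, 0 <= g y)%E ->
  IntRn g = (\int[mtuple n]_y g y)%E.
Proof.
elim: n g => [|n IHn] g mg g0; first by rewrite ge0_integral_mtuple0.
rewrite ge0_integral_mtupleS//=; apply: eq_integral => t _; apply: IHn => //.
by apply: measurableT_comp => //; exact: measurable_cons_tuple.
Qed.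

End TupleMeasure.

(** * Geometry of tuples *)

Section Geometry.
Context {R : realType}.
Local Notation leb := (@lebesgue_measure R).

(** The factor stands on the right so that [tscale (enorm y)^-1 y] unfolds to the tuple inside
    [sph_int]. *)
Definition tscale n (r : R) (y : n.-tuple R) : n.-tuple R :=
  [tuple of map (fun c => c * r) y].

Lemma tscale_cons n r t (y : n.-tuple R) :
  tscale r (cons_tuple t y) = cons_tuple (t * r) (tscale r y).
Proof. exact: val_inj. Qed.

Lemma dotp_cons n s t (x y : n.-tuple R) :
  dotp (cons_tuple s x) (cons_tuple t y) = s * t + dotp x y.
Proof.
rewrite /dotp big_ord_recl !tnth0; congr (_ + _).
by apply: eq_bigr => i _; rewrite !tnthS.
Qed.

Lemma dotpC n (x y : n.-tuple R) : dotp x y = dotp y x.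
Proof. by apply: eq_bigr => i _; rewrite mulrC. Qed.

Lemma dotp_tscale n r (x y : n.-tuple R) : dotp (tscale r x) y = r * dotp x y.
Proof.
rewrite /dotp mulr_sumr; apply: eq_bigr => i _.
by rewrite tnth_map [_ * r]mulrC mulrA.
Qed.

Lemma dotp_ge0 n (x : n.-tuple R) : 0 <= dotp x x.
Proof. by apply: sumr_ge0 => i _; rewrite -expr2 sqr_ge0. Qed.

Lemma enorm_ge0 n (x : n.-tuple R) : 0 <= enorm x.
Proof. exact: sqrtr_ge0. Qed.

Lemma sqr_enorm n (x : n.-tuple R) : enorm x ^+ 2 = dotp x x.
Proof. by rewrite sqr_sqrtr// dotp_ge0. Qed.

Lemma enorm_tscale n r (x : n.-tuple R) : 0 <= r -> enorm (tscale r x) = r * enorm x.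
Proof.
move=> r0; rewrite /enorm dotp_tscale dotpC dotp_tscale mulrA -expr2.
by rewrite sqrtrM ?sqr_ge0// sqrtr_sqr ger0_norm.
Qed.

Lemma enorm_cons n t (x : n.-tuple R) :
  enorm (cons_tuple t x) = Num.sqrt (t ^+ 2 + enorm x ^+ 2).
Proof. by rewrite sqr_enorm /enorm dotp_cons expr2. Qed.

Lemma measurable_dotp d (T : measurableType d) n (f g : T -> n.-tuple R) :
  measurable_fun setT f -> measurable_fun setT g ->
  measurable_fun setT (fun x => dotp (f x) (g x)).
Proof.
move=> /measurable_fun_tnthP mf /measurable_fun_tnthP mg.
by apply: measurable_sum => i; apply: measurable_funM; [exact: mf|exact: mg].
Qed.

Lemma measurable_enorm d (T : measurableType d) n (f : T -> n.-tuple R) :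
  measurable_fun setT f -> measurable_fun setT (fun x => enorm (f x)).
Proof.
move=> mf; apply: (@measurableT_comp _ _ _ _ _ _ (@Num.sqrt R)).
  by apply: continuous_measurable_fun; exact: sqrt_continuous.
exact: measurable_dotp.
Qed.

Lemma measurable_tscale d (T : measurableType d) n (r : T -> R) (f : T -> n.-tuple R) :
  measurable_fun setT r -> measurable_fun setT f ->
  measurable_fun setT (fun x => tscale (r x) (f x)).
Proof.
move=> mr /measurable_fun_tnthP mf; apply/measurable_fun_tnthP => i.
rewrite (_ : _ \o _ = (fun x => tnth (f x) i * r x)).
  by apply: measurable_funM => //; exact: mf.
by apply/funext => x /=; rewrite tnth_map.
Qed.

Lemma ge0_integral_tscale n r (g : n.-tuple R -> \bar R) : r != 0 ->
  measurable_fun setT g -> (forall y, 0 <= g y)%E ->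
  (\int[mtuple n]_y g y = (`|r| ^+ n)%:E * \int[mtuple n]_y g (tscale r y))%E.
Proof.
move=> r0; elim: n g => [|n IHn] g mg g0.
  rewrite !ge0_integral_mtuple0//; last first.
    by apply: measurableT_comp => //; exact: measurable_tscale.
  by rewrite expr0 mul1e; congr g; exact: val_inj.
have mG : measurable_fun [set: R] (fun t => \int[mtuple n]_y g (cons_tuple t y))%E.
  apply: measurable_ge0_integral => //.
  by apply: measurableT_comp => //; exact: measurable_cons_tuple.
have G0 t : (0 <= \int[mtuple n]_y g (cons_tuple t y))%E by exact: integral_ge0.
rewrite !ge0_integral_mtupleS//; last first.
  by apply: measurableT_comp => //; exact: measurable_tscale.
rewrite (ge0_integral_affine 0 r0 mG G0).
rewrite exprS EFinM -muleA; congr (_ * _)%E.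
rewrite -ge0_integralZl//; last 2 first.
- under eq_fun do under eq_integral do rewrite tscale_cons.
  apply: measurable_ge0_integral => //.
  apply: measurableT_comp => //; apply: measurable_cons_tuple.
    exact: measurable_funM.
  exact: measurable_tscale.
- by move=> t _; exact: integral_ge0.
apply: eq_integral => t _; rewrite addr0 IHn//.
  by congr *%E; apply: eq_integral => y _; rewrite tscale_cons mulrC.
by apply: measurableT_comp => //; exact: measurable_cons_tuple.
Qed.

End Geometry.

(** * Gaussian integrals *)

Section Gauss.
Context {R : realType}.
Local Notation leb := (@lebesgue_measure R).
Local Notation gauss := (@gauss_fun R).

Lemma measurable_gauss d (T : measurableType d) (f : T -> R) :
  measurable_fun setT f -> measurable_fun setT (fun x => (gauss (f x))%:E).
Proof.
move=> mf; apply/measurable_EFinP.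
by apply: (measurableT_comp (@measurable_gauss_fun R)).
Qed.

Lemma gaussE0 x : (0 <= (gauss x)%:E)%E.
Proof. by rewrite lee_fin gauss_fun_ge0. Qed.

(** Up to normalization this is the density at [u] of [a X + b Y] for independent Gaussian [X] and
    [Y]. Completing the square in [t] splits off the factor [gauss (u / c)]. *)
Lemma integral_gauss_conv (a b c u : R) : 0 < b -> 0 < c -> c ^+ 2 = a ^+ 2 + b ^+ 2 ->
  (\int[leb]_t (gauss t * gauss ((u - a * t) / b))%:E =
   (Num.sqrt pi * b / c * gauss (u / c))%:E)%E.
Proof.
move=> b0 c0 abc.
have cb0 : c / b != 0 by rewrite mulf_neq0 ?invr_eq0 ?gt_eqF.
(* Slope and shift come from [t^2 + ((u - a t) / b)^2 = (c t / b - a u / (b c))^2 + (u / c)^2]. *)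
have := ge0_integral_affine (- (a * u) / (b * c)) cb0
  (measurable_gauss (@measurable_id _ _ setT)) gaussE0.
rewrite integralT_gauss => E.
transitivity (\int[leb]_t ((gauss (u / c))%:E *
    (gauss (c / b * t + - (a * u) / (b * c)))%:E))%E.
  apply: eq_integral => t _; rewrite -EFinM /gauss_fun -!expRD; congr (expR _)%:E.
  have -> : (c / b * t + - (a * u) / (b * c)) ^+ 2 =
      (c ^+ 2) / b ^+ 2 * t ^+ 2 - 2 * a * u * t / b ^+ 2
       + (a ^+ 2) * u ^+ 2 / (b ^+ 2 * c ^+ 2).
    by field; rewrite !gt_eqF.
  have -> : a ^+ 2 = c ^+ 2 - b ^+ 2 by rewrite abc addrK.
  have -> : ((u - a * t) / b) ^+ 2 =
     (u ^+ 2 - 2 * a * u * t + (c ^+ 2 - b ^+ 2) * t ^+ 2) / b ^+ 2.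
    by have -> : c ^+ 2 - b ^+ 2 = a ^+ 2 by [rewrite abc addrK]; field; rewrite !gt_eqF.
  by field; rewrite !gt_eqF.
rewrite ge0_integralZl//; last 3 first.
- by apply: measurable_gauss; apply: measurable_affine.
- by move=> t _; exact: gaussE0.
- exact: gaussE0.
rewrite gtr0_norm in E; last by rewrite divr_gt0.
have -> : (\int[leb]_t (gauss (c / b * t + - (a * u) / (b * c)))%:E =
    (Num.sqrt pi * b / c)%:E)%E.
  transitivity ((b / c)%:E * (Num.sqrt pi)%:E)%E; last first.
    by rewrite -EFinM; congr EFin; ring.
  rewrite E muleA -EFinM (_ : b / c * (c / b) = 1) ?mul1e//.
  by field; rewrite !gt_eqF.
by rewrite -EFinM mulrC.
Qed.

Variable h : R -> \bar R.
Hypotheses (mh : measurable_fun setT h) (h0 : forall x, (0 <= h x)%E).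

(** Symmetry of the Gaussian. It serves the case [b = 0] of [integral_gauss_rotation], where the
    combined coefficient [sqrt (a^2)] is [|a|]. *)
Lemma integral_gauss_even (a : R) :
  (\int[leb]_t (h (a * t)%R * (gauss t)%:E) = \int[leb]_t (h (`|a| * t)%R * (gauss t)%:E))%E.
Proof.
have [a0|a0] := leP 0 a; first by rewrite ger0_norm.
rewrite (@ge0_integral_affine R (-1) 0 _ _).
- rewrite normrN1 mul1e (ltr0_norm a0); apply: eq_integral => t _.
  by rewrite addr0 mulN1r mulrN mulNr /gauss_fun sqrrN.
- by rewrite oppr_eq0 oner_eq0.
- apply: emeasurable_funM; last exact: measurable_gauss.
  by apply: measurableT_comp => //; exact: measurable_funM.
- by move=> t; apply: mule_ge0 => //; exact: gaussE0.
Qed.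

(** For independent Gaussians, [a X + b Y] is distributed as [sqrt (a^2 + b^2) X]. Substitute
    [u = a t + b s] in the inner integral, exchange, and integrate the kernel over [t] by
    [integral_gauss_conv]. The substitution degenerates at [b = 0], hence the separate case. *)
Lemma integral_gauss_rotation (a b : R) : 0 <= b ->
  (\int[leb]_t ((gauss t)%:E * \int[leb]_s (h (a * t + b * s)%R * (gauss s)%:E)) =
  (Num.sqrt pi)%:E *
   \int[leb]_s (h (Num.sqrt (a ^+ 2 + b ^+ 2) * s)%R * (gauss s)%:E))%E.
Proof.
rewrite le_eqVlt => /predU1P[<-|b0].
  rewrite expr0n addr0 sqrtr_sqr -integral_gauss_even -ge0_integralZl//; last 2 first.
  - apply: emeasurable_funM; last exact: measurable_gauss.
    by apply: measurableT_comp => //; exact: measurable_funM.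
  - by move=> t _; apply: mule_ge0 => //; exact: gaussE0.
  apply: eq_integral => t _.
  under eq_integral do rewrite mul0r addr0.
  rewrite ge0_integralZl//; last 2 first.
  - exact: measurable_gauss.
  - by move=> s _; exact: gaussE0.
  by rewrite integralT_gauss [RHS]muleC -[RHS]muleA muleCA.
pose c := Num.sqrt (a ^+ 2 + b ^+ 2); rewrite -/c.
have abc : c ^+ 2 = a ^+ 2 + b ^+ 2 by apply: sqr_sqrtr; apply: addr_ge0; exact: sqr_ge0.
have c0 : 0 < c by rewrite sqrtr_gt0 ltr_wpDl ?sqr_ge0// exprn_gt0.
pose F (t u : R) := ((gauss t * gauss ((u - a * t) / b))%:E * h u)%E.
have mK : measurable_fun setT
    (fun p : R * R => (gauss p.1 * gauss ((p.2 - a * p.1) / b))%:E).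
  apply/measurable_EFinP; apply: measurable_funM.
    exact: (measurableT_comp (@measurable_gauss_fun R)).
  apply: (measurableT_comp (@measurable_gauss_fun R)).
  apply: measurable_funM => //; apply: measurable_funB => //.
  exact: measurable_funM.
have mF : measurable_fun setT (fun p : R * R => F p.1 p.2).
  by apply: emeasurable_funM => //; exact: measurableT_comp.
have F0 t u : (0 <= F t u)%E.
  by apply: mule_ge0 => //; rewrite lee_fin mulr_ge0// gauss_fun_ge0.
transitivity (\int[leb]_t ((b^-1)%:E * \int[leb]_u F t u))%E.
  apply: eq_integral => t _.
  rewrite (@ge0_integral_affine R b (a * t) (F t)) ?gt_eqF//; last first.
    exact: measurableT_comp mF (pair1_measurable _).
  rewrite gtr0_norm// muleA -EFinM mulVf ?gt_eqF// mul1e -ge0_integralZl//; last 3 first.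
  - apply: emeasurable_funM; last exact: measurable_gauss.
    apply: measurableT_comp => //.
    under eq_fun do rewrite addrC; exact: measurable_affine.
  - by move=> s _; apply: mule_ge0 => //; exact: gaussE0.
  - exact: gaussE0.
  apply: eq_integral => s _; rewrite /F addrK [b * s / b]mulrAC divff ?gt_eqF// mul1r.
  by rewrite [b * s + _]addrC EFinM -muleA; congr (_ * _)%E; rewrite muleC.
rewrite ge0_integralZl//; last 3 first.
- exact: measurable_ge0_integral.
- by move=> t _; exact: integral_ge0.
- by rewrite lee_fin invr_ge0 ltW.
rewrite tonelli//.
transitivity ((b^-1)%:E * \int[leb]_u ((Num.sqrt pi * b / c)%:E * (h u * (gauss (u / c))%:E)))%E.
  congr (_ * _)%E; apply: eq_integral => u _.
  rewrite /F ge0_integralZr//; last 2 first.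
  - exact: measurableT_comp mK (pair2_measurable u).
  - by move=> t _; rewrite lee_fin mulr_ge0// gauss_fun_ge0.
  by rewrite (integral_gauss_conv _ b0 c0 abc) EFinM -muleA [(_ * h u)%E]muleC.
have mg : measurable_fun setT (fun u : R => h u * (gauss (u / c))%:E)%E.
  by apply: emeasurable_funM => //; apply: measurable_gauss; exact: measurable_funM.
have g0 u : (0 <= h u * (gauss (u / c))%:E)%E.
  by apply: mule_ge0 => //; exact: gaussE0.
rewrite ge0_integralZl//; last first.
  by rewrite lee_fin !mulr_ge0 ?invr_ge0 ?sqrtr_ge0 ?ltW.
rewrite (ge0_integral_affine 0 (lt0r_neq0 c0) mg g0) (gtr0_norm c0).
under eq_integral do rewrite addr0 [c * _ / c]mulrAC divff ?gt_eqF// mul1r.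
rewrite !muleA -!EFinM; congr (_%:E * _)%E.
by field; rewrite !gt_eqF.
Qed.

End Gauss.

Section GaussTuple.
Context {R : realType}.
Local Notation leb := (@lebesgue_measure R).
Local Notation gauss := (@gauss_fun R).

Definition gaussn n (y : n.-tuple R) : R := expR (- dotp y y).

Lemma gaussn_ge0 n (y : n.-tuple R) : (0 <= (gaussn y)%:E)%E.
Proof. by rewrite lee_fin expR_ge0. Qed.

Lemma gaussn_cons n t (y : n.-tuple R) :
  gaussn (cons_tuple t y) = gauss t * gaussn y.
Proof. by rewrite /gaussn /gauss_fun dotp_cons opprD expRD expr2. Qed.

Lemma gaussnE n (y : n.-tuple R) : gaussn y = gauss (enorm y).
Proof. by rewrite /gauss_fun sqr_enorm. Qed.

Lemma measurable_gaussn d (T : measurableType d) n (f : T -> n.-tuple R) :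
  measurable_fun setT f -> measurable_fun setT (fun x => (gaussn (f x))%:E).
Proof.
move=> mf; under eq_fun do rewrite gaussnE.
by apply: measurable_gauss; exact: measurable_enorm.
Qed.

(** Rotation invariance in the only form required: the law of [<v, Y>] for a Gaussian vector [Y]
    depends on [v] through its length. The coordinates are merged one by one with
    [integral_gauss_rotation]. The factor [sqrt pi] on the left replaces an exponent [n - 1] on the
    right and lets the induction start at [n = 0]. *)
Lemma integral_gaussn_dotp n (v : n.-tuple R) (h : R -> \bar R) :
  measurable_fun setT h -> (forall x, (0 <= h x)%E) ->
  ((Num.sqrt pi)%:E * \int[mtuple n]_y (h (dotp v y) * (gaussn y)%:E) =
   (Num.sqrt pi ^+ n)%:E * \int[leb]_s (h (enorm v * s)%R * (gauss s)%:E))%E.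
Proof.
elim: n v h => [|n IHn] v h mh h0.
  rewrite ge0_integral_mtuple0; last first.
    apply: emeasurable_funM; last exact: measurable_gaussn.
    by apply: measurableT_comp => //; exact: measurable_dotp.
  have -> : enorm v = 0 by rewrite /enorm /dotp big_ord0 sqrtr0.
  rewrite expr0 mul1e /gaussn /dotp !big_ord0 oppr0 expR0 mule1.
  under eq_integral do rewrite mul0r.
  rewrite ge0_integralZl//; last 2 first.
  - exact: measurable_gauss.
  - by move=> s _; exact: gaussE0.
  by rewrite integralT_gauss muleC.
have mhd d (T : measurableType d) (f : T -> R) k (w : k.-tuple R) (y : T -> k.-tuple R) :
    measurable_fun setT f -> measurable_fun setT y ->
    measurable_fun setT (fun x => h (f x + dotp w (y x))%R * (gaussn (y x))%:E)%E.
  move=> mf my; apply: emeasurable_funM; last exact: measurable_gaussn.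
  apply: measurableT_comp => //; apply: measurable_funD => //.
  exact: measurable_dotp.
case: (tupleP v) => a w.
rewrite ge0_integral_mtupleS//; last 2 first.
- apply: emeasurable_funM; last exact: measurable_gaussn.
  by apply: measurableT_comp => //; exact: measurable_dotp.
- by move=> y; apply: mule_ge0 => //; exact: gaussn_ge0.
pose H t := (\int[mtuple n]_y (h (a * t + dotp w y)%R * (gaussn y)%:E))%E.
transitivity ((Num.sqrt pi)%:E * \int[leb]_t ((gauss t)%:E * H t))%E.
  congr (_ * _)%E; apply: eq_integral => t _.
  rewrite /H -ge0_integralZl//; last 3 first.
  - exact: mhd.
  - by move=> y _; apply: mule_ge0 => //; exact: gaussn_ge0.
  - exact: gaussE0.
  by apply: eq_integral => y _; rewrite gaussn_cons dotp_cons EFinM muleCA.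
have mH : measurable_fun setT H.
  apply: measurable_ge0_integral.
    by apply: mhd => //; exact: measurable_funM.
  by move=> t y; apply: mule_ge0 => //; exact: gaussn_ge0.
have H0 t : (0 <= H t)%E.
  by apply: integral_ge0 => y _; apply: mule_ge0 => //; exact: gaussn_ge0.
rewrite -ge0_integralZl//; last 2 first.
- by apply: emeasurable_funM => //; exact: measurable_gauss.
- by move=> t _; apply: mule_ge0 => //; exact: gaussE0.
transitivity (\int[leb]_t ((Num.sqrt pi ^+ n)%:E * ((gauss t)%:E *
    \int[leb]_s (h (a * t + enorm w * s)%R * (gauss s)%:E))))%E.
  apply: eq_integral => t _.
  (* The induction hypothesis is applied to the translate of [h] by the contribution [a * t] of the
     first coordinate. *)
  rewrite muleCA (IHn w (fun x => h (a * t + x)%R))//; last first.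
    by apply: measurableT_comp => //; exact: measurable_funD.
  by rewrite muleCA.
have mi : measurable_fun setT (fun t => \int[leb]_s (h (a * t + enorm w * s)%R * (gauss s)%:E))%E.
  apply: measurable_ge0_integral.
    apply: emeasurable_funM; last exact: measurable_gauss.
    by apply: measurableT_comp => //; apply: measurable_funD; exact: measurable_funM.
  by move=> t s; apply: mule_ge0 => //; exact: gaussE0.
have i0 t : (0 <= \int[leb]_s (h (a * t + enorm w * s)%R * (gauss s)%:E))%E.
  by apply: integral_ge0 => s _; apply: mule_ge0 => //; exact: gaussE0.
rewrite ge0_integralZl//; last 2 first.
- by apply: emeasurable_funM => //; exact: measurable_gauss.
- by move=> t _; apply: mule_ge0 => //; exact: gaussE0.
rewrite integral_gauss_rotation ?enorm_ge0// muleA -EFinM -exprSr.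
by rewrite enorm_cons.
Qed.

End GaussTuple.

Section Radial.
Context {R : realType}.
Local Notation leb := (@lebesgue_measure R).
Local Notation gauss := (@gauss_fun R).

Lemma measurable_natb d (T : measurableType d) (b : T -> bool) :
  measurable_fun setT b -> measurable_fun setT (fun x => (b x)%:R : R).
Proof.
move=> mb; rewrite (_ : (fun x => _) = (fun x => if b x then 1 else 0 : R)).
  exact: measurable_fun_ifT.
by apply/funext => x; case: (b x).
Qed.

Lemma integral_indicb (b : R -> bool) (D : set R) (f : R -> R) : measurable D ->
  D = [set x | b x] ->
  (\int[leb]_x (f x * (b x)%:R)%:E = \int[leb]_(x in D) (f x)%:E)%E.
Proof.
move=> mD ->; rewrite [RHS]integral_mkcond; apply: eq_integral => x _.
rewrite patchE; case: ifPn => [/set_mem/= ->|/negP xD]; first by rewrite mulr1.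
have /negPf-> : ~~ b x by apply/negP => bx; apply: xD; exact/mem_set.
by rewrite mulr0.
Qed.

Lemma derive_gauss (x : R) : is_derive x 1 (fun y => - gauss y) (2 * x * gauss x).
Proof.
rewrite /gauss_fun; apply: is_derive_eq.
rewrite /GRing.scale/=.
ring.
Qed.

Lemma integral_gauss_tail (x : R) : 0 <= x ->
  (\int[leb]_s (2 * s * gauss s * (x <= s)%R%:R)%:E = (gauss x)%:E)%E.
Proof.
move=> x0; rewrite (@integral_indicb _ `[x, +oo[%classic)//; last first.
  by apply/seteqP; split => s /=; rewrite in_itv/= andbT.
have dF s : derivable (fun y : R => - gauss y) s 1.
  by have [] := derive_gauss s.
rewrite (@ge0_continuous_FTC2y R _ (fun y => - gauss y) x 0).
- by rewrite -EFinB opprK add0r.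
- by move=> s xs; rewrite !mulr_ge0 ?gauss_fun_ge0// (le_trans x0).
- apply: continuous_subspaceT => s; apply: cvgM; last exact: continuous_gauss_fun.
  by apply: cvgM => //; exact: cvg_cst.
- by rewrite -oppr0; apply: cvgN; exact: cvg_gauss_fun.
- by move=> s _; exact: dF.
- by apply: cvg_at_right_filter; apply: cvgN; exact: continuous_gauss_fun.
- by move=> s _; rewrite derive1E; have [_ ->] := derive_gauss s.
Qed.

Lemma integral_pow (k : nat) (r : R) : 0 < r ->
  (\int[leb]_s (s ^+ k * (0 < s <= r)%R%:R)%:E = (r ^+ k.+1 / k.+1%:R)%:E)%E.
Proof.
move=> r0; rewrite (@integral_indicb _ `]0, r]%classic)//.
have dF (s : R) : is_derive s (1 : R) (fun y : R => y ^+ k.+1 / k.+1%:R) (s ^+ k).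
  have dX : is_derive s (1 : R) (@GRing.exp R ^~ k.+1) (k.+1%:R * s ^+ k).
    apply: DeriveDef; first exact: exprn_derivable.
    by rewrite exp_derive /GRing.scale/= mulr1.
  have := is_deriveM dX (is_derive_cst (k.+1%:R^-1 : R) s (1 : R)).
  rewrite scaler0 add0r (_ : _ *: _ = s ^+ k)//.
  by rewrite /GRing.scale/= mulKf// pnatr_eq0.
have cX j : continuous (fun y : R => y ^+ j) by exact: exprn_continuous.
rewrite integral_itv_obnd_cbnd; last first.
  by apply/measurable_EFinP; apply: measurable_funTS; exact: exprn_measurable.
rewrite (@continuous_FTC2 R _ (fun y => y ^+ k.+1 / k.+1%:R) 0 r)//.
- by rewrite expr0n mul0r -EFinB subr0.
- exact: continuous_subspaceT.
- split=> [s _| |].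
  + by have [] := dF s.
  + by apply: cvg_at_right_filter; apply: cvgM; [exact: cX|exact: cvg_cst].
  + by apply: cvg_at_left_filter; apply: cvgM; [exact: cX|exact: cvg_cst].
- by move=> s _; rewrite derive1E; have [_ ->] := dF s.
Qed.

End Radial.

(** * Polar coordinates *)

Section GaussMoments.
Context {R : realType}.
Local Notation leb := (@lebesgue_measure R).
Local Notation gauss := (@gauss_fun R).

(** This is [Gamma ((k + 1) / 2) / 2]. It enters through a two-step recurrence, its value at 1, and
    a lower bound on the ratio of consecutive moments. *)
Definition half_moment (k : nat) : \bar R :=
  (\int[leb]_s (s ^+ k * gauss s * (0 < s)%R%:R)%:E)%E.

Lemma measurable_half_moment d (T : measurableType d) k (f : T -> R) :
  measurable_fun setT f ->
  measurable_fun setT (fun x => (f x ^+ k * gauss (f x) * (0 < f x)%R%:R)%:E).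
Proof.
move=> mf; apply/measurable_EFinP; apply: measurable_funM; last first.
  by apply: measurable_natb; exact: measurable_fun_ltr.
apply: measurable_funM; first exact: measurable_funX.
exact: (measurableT_comp (@measurable_gauss_fun R)).
Qed.

Lemma half_moment_fun_ge0 k s : (0 <= (s ^+ k * gauss s * (0 < s)%R%:R)%:E)%E.
Proof.
rewrite lee_fin; have [s0|_] := boolP (0 < s); last by rewrite mulr0.
by rewrite mulr1 mulr_ge0 ?gauss_fun_ge0// exprn_ge0// ltW.
Qed.

Lemma half_moment_ge0 k : (0 <= half_moment k)%E.
Proof. by apply: integral_ge0 => s _; exact: half_moment_fun_ge0. Qed.

(* For r > 0, r^{k+1} = (k+1) int_0^r s^k ds; exchange the two integrals. *)
Lemma half_momentSS k :
  (2%:E * half_moment k.+2 = k.+1%:R%:E * half_moment k)%E.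
Proof.
pose F (r s : R) : \bar R :=
  ((2 * r * gauss r * (s <= r)%R%:R)%:E * (s ^+ k * (0 < s)%R%:R)%:E)%E.
have F0 r s : (0 <= F r s)%E.
  rewrite /F -EFinM lee_fin.
  have [s0|_] := boolP (0 < s); last by rewrite !mulr0.
  have [sr|_] := boolP (s <= r); last by rewrite mulr0 mul0r.
  by rewrite !mulr1 !mulr_ge0 ?gauss_fun_ge0 ?exprn_ge0 ?ltW// (lt_le_trans s0).
have mtail : measurable_fun setT
    (fun p : R * R => (2 * p.1 * gauss p.1 * (p.2 <= p.1)%R%:R)%:E).
  apply/measurable_EFinP; apply: measurable_funM.
    apply: measurable_funM; first exact: measurable_funM.
    exact: (measurableT_comp (@measurable_gauss_fun R)).
  by apply: measurable_natb; exact: measurable_fun_ler.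
have mF : measurable_fun setT (fun p : R * R => F p.1 p.2).
  apply: emeasurable_funM; first exact: mtail.
  apply/measurable_EFinP.
  apply: measurable_funM; first exact: measurable_funX.
  by apply: measurable_natb; exact: measurable_fun_ltr.
transitivity (k.+1%:R%:E * \int[leb]_r \int[leb]_s F r s)%E.
  rewrite /half_moment -ge0_integralZl; last 4 first.
  - by [].
  - exact: measurable_half_moment.
  - by move=> r _; exact: half_moment_fun_ge0.
  - by rewrite lee_fin.
  rewrite -ge0_integralZl; last 4 first.
  - by [].
  - exact: measurable_ge0_integral.
  - by move=> r _; apply: integral_ge0.
  - by rewrite lee_fin.
  apply: eq_integral => r _; have [r0|r0] := ltP 0 r; last first.
    rewrite [X in (_ * X)%E = _](_ : _ = 0%E) ?mulr0// mule0.
    rewrite integral0_eq ?mule0// => s _; rewrite /F -EFinM.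
    have [s0|_] := boolP (0 < s); last by rewrite !mulr0.
    by rewrite leNgt (le_lt_trans r0 s0) mulr0 mul0r.
  have -> : (\int[leb]_s F r s = (2 * r * gauss r)%:E *
      \int[leb]_s (s ^+ k * (0 < s <= r)%R%:R)%:E)%E.
    rewrite -ge0_integralZl; last 4 first.
    - by [].
    - apply/measurable_EFinP; apply: measurable_funM; first exact: exprn_measurable.
      apply: measurable_natb; apply: measurable_and.
        exact: measurable_fun_ltr.
      exact: measurable_fun_ler.
    - move=> s _; rewrite lee_fin; have [s0|_] := boolP (0 < s); last by rewrite mulr0.
      by rewrite mulr_ge0// exprn_ge0// ltW.
    - by rewrite lee_fin !mulr_ge0 ?gauss_fun_ge0 ?ltW.
    apply: eq_integral => s _; rewrite /F -!EFinM; congr EFin.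
    by case: (0 < s); case: (s <= r) => /=; ring.
  rewrite (integral_pow k r0) -!EFinM /= mulr1; congr EFin.
  have : k.+1%:R != 0 :> R by rewrite pnatr_eq0.
  rewrite [r ^+ k.+2]exprS; move: (r ^+ k.+1) (gauss r) (k.+1%:R : R) => z g c c0.
  by field.
congr (_ * _)%E; rewrite tonelli//.
apply: eq_integral => s _; rewrite /F.
have [s0|s0] := boolP (0 < s); last first.
  by rewrite !mulr0; apply: integral0_eq => r _; rewrite mule0.
rewrite ge0_integralZr; last 4 first.
- by [].
- exact: measurableT_comp mtail (pair2_measurable s).
- move=> r _; rewrite lee_fin; have [sr|_] := boolP (s <= r); last by rewrite mulr0.
  by rewrite !mulr_ge0 ?gauss_fun_ge0// (le_trans _ sr)// ltW.
- by rewrite lee_fin mulr_ge0// exprn_ge0// ltW.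
by rewrite integral_gauss_tail ?ltW// -EFinM !mulr1 mulrC.
Qed.

Definition ball_int n (h : n.-tuple R -> \bar R) : \bar R :=
  (\int[mtuple n]_y (h y * (enorm y <= 1)%R%:R%:E))%E.

Section Homogeneous.
Variables (n p : nat) (h : n.-tuple R -> \bar R).
Hypotheses (mh : measurable_fun setT h) (h0 : forall y, (0 <= h y)%E).
Hypothesis hZ : forall (r : R) y, 0 < r -> h (tscale r y) = ((r ^+ p)%:E * h y)%E.

Lemma measurable_homog_ball d (T : measurableType d) (f : T -> n.-tuple R) (r : T -> R) :
  measurable_fun setT f -> measurable_fun setT r ->
  measurable_fun setT (fun x => h (f x) * (enorm (f x) <= r x)%R%:R%:E)%E.
Proof.
move=> mf mr; apply: emeasurable_funM; first exact: measurableT_comp.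
apply/measurable_EFinP; apply: measurable_natb.
by apply: measurable_fun_ler => //; exact: measurable_enorm.
Qed.

Lemma homog_ball_ge0 y r : (0 <= h y * (enorm y <= r)%R%:R%:E)%E.
Proof. by apply: mule_ge0 => //; rewrite lee_fin. Qed.

Lemma ball_int_ge0 : (0 <= ball_int h)%E.
Proof. by apply: integral_ge0 => y _; exact: homog_ball_ge0. Qed.

(** Dilation contributes [r^n] from Lebesgue measure and [r^p] from the homogeneity of [h]. *)
Lemma ball_intZ (r : R) : 0 < r ->
  (\int[mtuple n]_y (h y * (enorm y <= r)%R%:R%:E) =
   (r ^+ (n + p))%:E * ball_int h)%E.
Proof.
move=> r0; rewrite (ge0_integral_tscale (lt0r_neq0 r0)); last 2 first.
- exact: measurable_homog_ball.
- by move=> y; exact: homog_ball_ge0.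
rewrite gtr0_norm// exprD EFinM -muleA; congr (_ * _)%E.
rewrite /ball_int -ge0_integralZl; last 4 first.
- by [].
- exact: measurable_homog_ball.
- by move=> y _; exact: homog_ball_ge0.
- by rewrite lee_fin exprn_ge0// ltW.
apply: eq_integral => y _; rewrite hZ// -muleA.
have -> // : (enorm (tscale r y) <= r) = (enorm y <= 1).
by rewrite (enorm_tscale _ (ltW r0)) -[X in _ <= X]mulr1 ler_pM2l.
Qed.

(* Layer cake: exp(-|y|^2) = int_{s >= |y|} 2 s exp(-s^2) ds. *)
Lemma integral_homog_gaussn :
  (\int[mtuple n]_y (h y * (gaussn y)%:E) =
   2%:E * half_moment (n + p).+1 * ball_int h)%E.
Proof.
pose F (y : n.-tuple R) (s : R) : \bar R :=
  ((2 * s * gauss s * (0 < s)%R%:R)%:E * (h y * (enorm y <= s)%R%:R%:E))%E.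
have mtail d (T : measurableType d) (f : T -> R) : measurable_fun setT f ->
    measurable_fun setT (fun x => (2 * f x * gauss (f x) * (0 < f x)%R%:R)%:E).
  move=> mf; under eq_fun do rewrite -[f _ in X in X * gauss _]expr1 -!mulrA EFinM mulrA.
  by apply: emeasurable_funM => //; exact: measurable_half_moment.
have tail0 s : (0 <= (2 * s * gauss s * (0 < s)%R%:R)%:E)%E.
  by have := half_moment_fun_ge0 1 s; rewrite !lee_fin expr1 -!mulrA => ?; rewrite mulr_ge0.
have mF : measurable_fun setT (fun q : n.-tuple R * R => F q.1 q.2).
  by apply: emeasurable_funM; [exact: mtail|exact: measurable_homog_ball].
have F0 y s : (0 <= F y s)%E.
  by apply: mule_ge0; [exact: tail0|exact: homog_ball_ge0].
transitivity (\int[mtuple n]_y \int[leb]_s F y s)%E.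
  apply: eq_integral => y _.
  rewrite gaussnE -(integral_gauss_tail (enorm_ge0 y)) -ge0_integralZl; last 4 first.
  - by [].
  - apply/measurable_EFinP; apply: measurable_funM.
      apply: measurable_funM; first exact: mulrl_measurable.
      exact: measurable_gauss_fun.
    by apply: measurable_natb; exact: measurable_fun_ler.
  - move=> s _; rewrite lee_fin; have [sr|_] := boolP (_ <= s); last by rewrite mulr0.
    by rewrite !mulr_ge0 ?gauss_fun_ge0// (le_trans _ sr)// enorm_ge0.
  - exact: h0.
  apply: eq_integral => s _; rewrite /F muleCA -EFinM; congr (_ * _%:E)%E.
  have [ys|] := boolP (_ <= s); last by rewrite !mulr0.
  have := le_trans (enorm_ge0 y) ys; rewrite le_eqVlt => /predU1P[<-|->].
    by rewrite mulr0 !mul0r.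
  by rewrite !mulr1.
rewrite tonelli//.
transitivity (\int[leb]_s (2%:E * (s ^+ (n + p).+1 * gauss s * (0 < s)%R%:R)%:E
   * ball_int h))%E.
  apply: eq_integral => s _; rewrite /F.
  rewrite ge0_integralZl; last 4 first.
  - by [].
  - exact: measurable_homog_ball.
  - by move=> y _; exact: homog_ball_ge0.
  - exact: tail0.
  have [s0|s0] := boolP (0 < s); last by rewrite !mulr0 mule0 !mul0e.
  rewrite ball_intZ// muleA -!EFinM; congr (_%:E * _)%E.
  by rewrite exprSr; ring.
rewrite ge0_integralZr; last 4 first.
- by [].
- by apply: emeasurable_funM => //; exact: measurable_half_moment.
- by move=> s _; apply: mule_ge0; [rewrite lee_fin|exact: half_moment_fun_ge0].
- exact: ball_int_ge0.
rewrite ge0_integralZl; last 4 first.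
- by [].
- exact: measurable_half_moment.
- by move=> s _; exact: half_moment_fun_ge0.
- by rewrite lee_fin.
by [].
Qed.

End Homogeneous.
End GaussMoments.

(** * Estimates of half-line moments; ball integrals in degrees 0 and 1 *)

Section BallIntegrals.
Context {R : realType}.
Local Notation leb := (@lebesgue_measure R).
Local Notation gauss := (@gauss_fun R).

Lemma half_moment1 : half_moment 1 = (2^-1 : R)%:E.
Proof.
have := @integral_gauss_tail R 0 (lexx _); rewrite /gauss_fun expr0n oppr0 expR0.
have -> : (\int[leb]_s (2 * s * expR (- s ^+ 2) * (0 <= s)%R%:R)%:E =
    2%:E * half_moment 1)%E.
  rewrite /half_moment -ge0_integralZl; last 4 first.
  - by [].
  - exact: measurable_half_moment.
  - by move=> s _; exact: half_moment_fun_ge0.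
  - by rewrite lee_fin.
  apply: eq_integral => s _; rewrite -EFinM expr1 /gauss_fun; congr EFin.
  (* The closed and the open half-line differ only at [s = 0], where the factor [s] vanishes. *)
  by case: (ltgtP 0 s) => [_|_|<-] /=; ring.
case: half_moment (@half_moment_ge0 R 1) => [x _|_|//].
  by rewrite -EFinM => -[x2]; congr EFin; lra.
by rewrite gt0_muley ?lte_fin.
Qed.

Lemma half_moment_fin k : @half_moment R k \is a fin_num.
Proof.
(* The recurrence advances by two, so two consecutive moments are carried along. *)
suff : @half_moment R k \is a fin_num /\ @half_moment R k.+1 \is a fin_num by case.
elim: k => [|k [IH0 IH1]]; last split=> //.
  rewrite half_moment1; split => //.
  rewrite ge0_fin_numE ?half_moment_ge0//.
  apply: (@le_lt_trans _ _ (\int[leb]_t (gauss t)%:E)%E); last first.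
    by rewrite integralT_gauss ltry.
  apply: ge0_le_integral => //.
  - by move=> s _; exact: half_moment_fun_ge0.
  - exact: measurable_half_moment.
  - exact: measurable_gauss.
  - move=> s _; rewrite lee_fin expr0 mul1r.
    by case: (0 < s); rewrite ?mulr1// mulr0 gauss_fun_ge0.
have := @half_momentSS R k.
case: half_moment (@half_moment_ge0 R k.+2) => [//|_|//].
by rewrite gt0_muley ?lte_fin// -(fineK IH0).
Qed.

(* AM-GM under the integral, [2 s^{k+1} <= s^{k+2} / b + b s^k], with the [b]
   that makes both terms on the right equal. *)
Lemma half_moment_ratio k :
  fine (@half_moment R k.+1) * Num.sqrt (k.+1%:R / 2) <= fine (@half_moment R k.+2).
Proof.
set b := Num.sqrt _.
have b0 : 0 < b by rewrite sqrtr_gt0 divr_gt0.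
have bb : b ^+ 2 = k.+1%:R / 2 by rewrite sqr_sqrtr// divr_ge0.
have /(congr1 fine) := @half_momentSS R k.
rewrite !fineM ?half_moment_fin//= => jj.
have : ((2 * b)%:E * half_moment k.+1 <= half_moment k.+2 + (b ^+ 2)%:E * half_moment k)%E.
  rewrite /half_moment -ge0_integralZl; last 4 first.
  - by [].
  - exact: measurable_half_moment.
  - by move=> s _; exact: half_moment_fun_ge0.
  - by rewrite lee_fin mulr_ge0// ltW.
  rewrite -ge0_integralZl; last 4 first.
  - by [].
  - exact: measurable_half_moment.
  - by move=> s _; exact: half_moment_fun_ge0.
  - by rewrite lee_fin exprn_ge0// ltW.
  rewrite -ge0_integralD; last 5 first.
  - by [].
  - by move=> s _; exact: half_moment_fun_ge0.
  - exact: measurable_half_moment.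
  - by move=> s _; apply: mule_ge0; [rewrite lee_fin sqr_ge0|exact: half_moment_fun_ge0].
  - by apply: emeasurable_funM => //; exact: measurable_half_moment.
  apply: ge0_le_integral; [by []|..].
  - move=> s _; apply: mule_ge0; last exact: half_moment_fun_ge0.
    by rewrite lee_fin mulr_ge0// ltW.
  - by apply: emeasurable_funM => //; exact: measurable_half_moment.
  - apply: emeasurable_funD; first exact: measurable_half_moment.
    by apply: emeasurable_funM => //; exact: measurable_half_moment.
  move=> s _; rewrite -!EFinM -EFinD lee_fin.
  have := half_moment_fun_ge0 k s; rewrite lee_fin => g0.
  rewrite -subr_ge0 !exprS (_ : _ - _ = (s - b) ^+ 2 * (s ^+ k * gauss s * (0 < s)%R%:R)).
    by rewrite mulr_ge0// sqr_ge0.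
  by ring.
rewrite -(fineK (half_moment_fin k)) -(fineK (half_moment_fin k.+1)).
rewrite -(fineK (half_moment_fin k.+2)) -!EFinM -EFinD lee_fin bb.
move: (fine _) (fine _) (fine _) jj => j1 j2 j0 jj H /=.
lra.
Qed.

Section DegreeZero.
Variables (n : nat) (f : n.-tuple R -> \bar R).
Hypotheses (mf : measurable_fun setT f) (f0 : forall y, (0 <= f y)%E).
Hypothesis fZ : forall (r : R) y, 0 < r -> f (tscale r y) = f y.

(* [1 - |y|] is the measure of the [s] in [0, 1] with [|y| <= s]. *)
Lemma ball_int_norm : ball_int f =
  (ball_int (fun y => f y * (enorm y)%:E) + (n.+1%:R^-1)%:E * ball_int f)%E.
Proof.
(* Requiring [0 < s] keeps the radius positive, as [ball_intZ] demands. *)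
pose c (x s : R) : R := ((x <= s)%R && (0 < s <= 1)%R)%:R.
have mc : measurable_fun setT (fun p : n.-tuple R * R => c (enorm p.1) p.2).
  apply: measurable_natb; apply: measurable_and.
    by apply: measurable_fun_ler => //; exact: measurable_enorm.
  by apply: measurable_and; [exact: measurable_fun_ltr|exact: measurable_fun_ler].
pose F y s := (f y * (c (enorm y) s)%:E)%E.
have mF : measurable_fun setT (fun p : n.-tuple R * R => F p.1 p.2).
  apply: emeasurable_funM; first exact: measurableT_comp.
  exact/measurable_EFinP.
have F0 y s : (0 <= F y s)%E by apply: mule_ge0 => //; rewrite lee_fin.
have cE x : 0 <= x -> (\int[leb]_s (c x s)%:E = ((1 - x) * (x <= 1)%R%:R)%:E)%E.
  move=> x0; have [x1|x1] := boolP (x <= 1); last first.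
    rewrite mulr0 integral0_eq// => s _; rewrite /c.
    case: (boolP (x <= s)) => //= xs; case: (boolP (s <= 1)) => s1.
      by rewrite (le_trans xs s1) in x1.
    by rewrite andbF.
  (* The condition [0 < s] removes the left endpoint exactly when [x = 0]; the length is [1 - x] in
     both cases. *)
  rewrite mulr1; pose D := if x == 0 then `]0, 1]%classic else `[x, 1]%classic.
  have DE : D = [set s | (x <= s)%R && (0 < s <= 1)%R].
    rewrite /D; case: eqVneq => [->|xN0].
      by apply/seteqP; split => s /=; rewrite in_itv/=; case: (ltgtP 0 s).
    have x_gt0 : 0 < x by rewrite lt_neqAle eq_sym xN0.
    apply/seteqP; split => s /=; rewrite in_itv/=.
      by move=> /andP[xs ->]; rewrite xs (lt_le_trans x_gt0 xs).
    by move=> /andP[-> /andP[_ ->]].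
  transitivity (\int[leb]_s (1 * ((x <= s)%R && (0 < s <= 1)%R)%:R)%:E)%E.
    by apply: eq_integral => s _; rewrite mul1r.
  have mD : measurable D by rewrite /D; case: ifP.
  rewrite (integral_indicb (fun=> 1) mD DE) integral_cst// mul1e /D.
  case: eqVneq => [->|xN0] /=; rewrite [LHS]lebesgue_measure_itv/= lte_fin.
    by rewrite ltr01 -EFinB.
  case: ltP => [_|x1']; first by rewrite -EFinB.
  by rewrite (@le_anti _ _ x 1) ?x1// subrr.
have E2 : (\int[mtuple n]_y \int[leb]_s F y s = (n.+1%:R^-1)%:E * ball_int f)%E.
  rewrite tonelli//.
  (* For fixed [s] the slice is the ball of radius [s], with integral [s^n] times that over the unit
     ball; then [s^n] integrates to [1 / (n + 1)] over the unit interval. *)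
  transitivity (\int[leb]_s ((s ^+ n * (0 < s <= 1)%R%:R)%:E * ball_int f))%E.
    apply: eq_integral => s _; rewrite /F /c.
    have [s01|s01] := boolP (0 < s <= 1); last first.
      rewrite mulr0 mul0e integral0_eq// => y _.
      by rewrite andbF mule0.
    under eq_integral do rewrite andbT.
    rewrite (@ball_intZ R n 0 f mf f0 _ s) ?addn0 ?mulr1//; last by case/andP: s01.
    by move=> r y r0; rewrite fZ// expr0 mul1e.
  rewrite ge0_integralZr; last 4 first.
  - by [].
  - apply/measurable_EFinP; apply: measurable_funM; first exact: exprn_measurable.
    apply: measurable_natb; apply: measurable_and.
      exact: measurable_fun_ltr.
    exact: measurable_fun_ler.
  - move=> s _; rewrite lee_fin; have [s0|_] := boolP (0 < s); last by rewrite mulr0.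
    by rewrite mulr_ge0// exprn_ge0// ltW.
  - exact: ball_int_ge0.
  by rewrite integral_pow// expr1n mul1r.
rewrite -E2 /ball_int -ge0_integralD; last 5 first.
- by [].
- move=> y _; apply: mule_ge0; last by rewrite lee_fin.
  by apply: mule_ge0 => //; rewrite lee_fin enorm_ge0.
- apply: emeasurable_funM; last first.
    apply/measurable_EFinP; apply: measurable_natb.
    by apply: measurable_fun_ler => //; exact: measurable_enorm.
  by apply: emeasurable_funM => //; apply/measurable_EFinP; exact: measurable_enorm.
- by move=> y _; exact: integral_ge0.
- exact: measurable_ge0_integral.
apply: eq_integral => y _; rewrite /F ge0_integralZl; last 4 first.
- by [].
- apply/measurable_EFinP; exact: measurableT_comp mc (pair1_measurable y).
- by move=> s _; rewrite lee_fin.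
- exact: f0.
rewrite cE ?enorm_ge0// -muleA -ge0_muleDr -?EFinM ?lee_fin//; last 2 first.
- by rewrite mulr_ge0// enorm_ge0.
- by case: (leP (enorm y) 1) => y1; rewrite ?mulr0// mulr1 subr_ge0.
by rewrite -EFinD; congr (_ * _%:E)%E; ring.
Qed.

End DegreeZero.
End BallIntegrals.

(** * Ball integral of the positive part of a linear form *)

Section HalfspaceMean.
Context {R : realType}.
Local Notation leb := (@lebesgue_measure R).
Local Notation gauss := (@gauss_fun R).

Definition tsub n (x y : n.-tuple R) : n.-tuple R :=
  [tuple tnth x i - tnth y i | i < n].

Lemma dotp_tsub n (x y z : n.-tuple R) : dotp (tsub x y) z = dotp x z - dotp y z.
Proof.
rewrite /dotp -sumrB; apply: eq_bigr => i _.
by rewrite tnth_mktuple mulrBl.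
Qed.

Lemma measurable_tsub d (T : measurableType d) n (f g : T -> n.-tuple R) :
  measurable_fun setT f -> measurable_fun setT g ->
  measurable_fun setT (fun x => tsub (f x) (g x)).
Proof.
move=> /measurable_fun_tnthP mf /measurable_fun_tnthP mg.
apply/measurable_fun_tnthP => i.
rewrite (_ : _ \o _ = (fun x => tnth (f x) i - tnth (g x) i)).
  by apply: measurable_funB; [exact: mf|exact: mg].
by apply/funext => x /=; rewrite tnth_mktuple.
Qed.

Lemma sqr_enorm_tsub n (x y : n.-tuple R) :
  enorm (tsub x y) ^+ 2 = dotp x x - 2 * dotp x y + dotp y y.
Proof.
rewrite sqr_enorm dotp_tsub ![dotp _ (tsub _ _)]dotpC !dotp_tsub [dotp y x]dotpC.
by ring.
Qed.

Lemma dotp_le n (x y : n.-tuple R) : 2 * dotp x y <= dotp x x + dotp y y.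
Proof. by have := sqr_ge0 (enorm (tsub x y)); rewrite sqr_enorm_tsub; lra. Qed.

Lemma enorm_eq0_dotp n (x y : n.-tuple R) : enorm y = 0 -> dotp x y = 0.
Proof.
move=> y0; have /eqP : dotp y y = 0 by rewrite -sqr_enorm y0 expr0n.
rewrite psumr_eq0 => [/allP yE|i _]; last by rewrite -expr2 sqr_ge0.
apply: big1 => i _; have := yE i (mem_index_enum i).
by rewrite /= mulf_eq0 orbb => /eqP ->; rewrite mulr0.
Qed.

Let sqrtpi_gt0 : 0 < Num.sqrt pi :> R.
Proof. by rewrite sqrtr_gt0 pi_gt0. Qed.

(** The total Gaussian mass computed twice, as a product and by layers of balls. It encodes the
    volume [pi^(n/2) / Gamma (n/2 + 1)] of the ball. Since the product is finite and nonzero, the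
    next lemmas read positivity and finiteness of its factors off it. *)
Lemma ball_int_cst1 n :
  (2%:E * half_moment n.+1 * @ball_int R n (cst 1) = (Num.sqrt pi ^+ n)%:E)%E.
Proof.
have le01 (T : Type) (x : T) : (0 <= (cst 1 x : \bar R))%E by exact: lee01.
have := @integral_gaussn_dotp R n [tuple 0 | i < n] (cst 1%E)
  (measurable_cst _) (@le01 _).
have := @integral_homog_gaussn R n 0 (cst 1%E) (measurable_cst _) (@le01 _).
rewrite addn0 => -> //; last by move=> r y r0; rewrite expr0 mule1.
rewrite /=; under eq_integral do rewrite mul1e.
rewrite integralT_gauss [RHS]muleC.
have : (0 <= 2%:E * half_moment n.+1 * @ball_int R n (cst 1))%E.
  by rewrite !mule_ge0 ?half_moment_ge0 ?ball_int_ge0.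
case: (_ * ball_int _)%E => [x _|_|//].
  rewrite -!EFinM => -[/mulfI->//]; exact: lt0r_neq0.
by rewrite gt0_muley ?lte_fin.
Qed.

Lemma half_moment_gt0 n : 0 < fine (@half_moment R n.+1).
Proof.
rewrite lt_neqAle fine_ge0 ?half_moment_ge0// andbT eq_sym; apply/eqP => j0.
have := ball_int_cst1 n; rewrite -(fineK (half_moment_fin n.+1)) j0 mule0 mul0e.
by case=> /esym/eqP; rewrite expf_eq0 gt_eqF ?andbF.
Qed.

Lemma ball_int_cst1_fin n : @ball_int R n (cst 1%E) \is a fin_num.
Proof.
have := ball_int_cst1 n; rewrite -(fineK (half_moment_fin n.+1)) -EFinM.
have : (0 <= @ball_int R n (cst 1))%E by exact: ball_int_ge0.
by case: ball_int => // _; rewrite gt0_muley// lte_fin mulr_gt0// half_moment_gt0.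
Qed.

Lemma ball_int_cst1_gt0 n : 0 < fine (@ball_int R n (cst 1%E)).
Proof.
rewrite lt_neqAle fine_ge0 ?ball_int_ge0// andbT eq_sym; apply/eqP => j0.
have := ball_int_cst1 n; rewrite -(fineK (ball_int_cst1_fin n)) j0 mule0.
by case=> /esym/eqP; rewrite expf_eq0 gt_eqF ?andbF.
Qed.

Definition posdot n (v y : n.-tuple R) : R := Num.max (dotp v y) 0.

Lemma posdot_ge0 n (v y : n.-tuple R) : 0 <= posdot v y.
Proof. by rewrite /posdot le_max lexx orbT. Qed.

Lemma posdotZ n (v y : n.-tuple R) r : 0 <= r ->
  posdot v (tscale r y) = r * posdot v y.
Proof.
by move=> r0; rewrite /posdot dotpC dotp_tscale dotpC maxr_pMr// mulr0.
Qed.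

Lemma measurable_posdot d (T : measurableType d) n (v y : T -> n.-tuple R) :
  measurable_fun setT v -> measurable_fun setT y ->
  measurable_fun setT (fun x => posdot (v x) (y x)).
Proof. by move=> mv my; apply: measurable_maxr => //; exact: measurable_dotp. Qed.

(** The integral reduces to dimension one, where it is [enorm v] times the first half-line moment;
    that moment is the source of the [1/2]. *)
Lemma integral_posdot_gaussn n (v : n.-tuple R) :
  ((Num.sqrt pi)%:E * \int[mtuple n]_y ((posdot v y)%:E * (gaussn y)%:E) =
   (Num.sqrt pi ^+ n * (enorm v / 2))%:E)%E.
Proof.
rewrite (@integral_gaussn_dotp R n v (fun x => (Num.max x 0)%:E)); last 2 first.
- by apply/measurable_EFinP; apply: measurable_maxr.
- by move=> x; rewrite lee_fin le_max lexx orbT.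
rewrite EFinM; congr (_ * _)%E.
rewrite EFinM -half_moment1 /half_moment -ge0_integralZl; last 4 first.
- by [].
- exact: measurable_half_moment.
- by move=> s _; exact: half_moment_fun_ge0.
- by rewrite lee_fin enorm_ge0.
apply: eq_integral => s _; rewrite -!EFinM; congr EFin.
rewrite -[in Num.max _ _](mulr0 (enorm v)) -maxr_pMr ?enorm_ge0// -mulrA expr1.
by congr (_ * _); case: ltP => s0 /=; rewrite ?mulr1// mulr0 mul0r.
Qed.

Lemma measurable_enormV d (T : measurableType d) n (f : T -> n.-tuple R) :
  measurable_fun setT f -> measurable_fun setT (fun x => (enorm (f x))^-1).
Proof.
move=> mf; under eq_fun do rewrite -powR_inv1 ?enorm_ge0//.
apply: (@measurableT_comp _ _ _ _ _ _ (fun x : R => x `^ (-1))).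
  exact: measurable_powR.
exact: measurable_enorm.
Qed.

(** A crude bound whose purpose is finiteness in [ball_int_posdot]: AM-GM applied to [v] and the
    unit vector along [y]. At the origin the quotient is 0, since the inverse of 0 is 0. *)
Lemma posdot_norm_le n (v y : n.-tuple R) :
  posdot v y / enorm y <= (dotp v v + 1) / 2.
Proof.
have [y0|y0] := eqVneq (enorm y) 0; first by rewrite y0 invr0 mulr0 divr_ge0// addr_ge0// dotp_ge0.
have e0 : 0 < enorm y by rewrite lt_neqAle eq_sym y0 enorm_ge0.
have := dotp_le v (tscale (enorm y)^-1 y).
rewrite dotp_tscale ![dotp _ (tscale _ _)]dotpC !dotp_tscale -(sqr_enorm y).
rewrite expr2 mulKf// mulVf// [dotp y v]dotpC => H.
have vv := dotp_ge0 v.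
rewrite ler_pdivrMr// /posdot ge_max; apply/andP; split.
  by rewrite -ler_pdivrMr// mulrC; lra.
by apply: mulr_ge0; [lra|exact: ltW].
Qed.

(** The real arithmetic of [ball_int_posdot]. There [e] is [|v|], [P] is [sqrt pi ^+ d.+1], [V] the
    volume of the ball, [j1] and [j2] the half-line moments of orders [d + 2] and [d + 3], and [A],
    [B] the ball integrals in degrees 0 and 1. The equations give [A = (d + 2) / (d + 1) * B] and
    [B = V e j1 / (2 sqrt pi j2)], and [j1 / j2] is at most [sqrt (2 / (d + 2))]. *)
Lemma ball_int_posdot_arith d (e P V j1 j2 A B : R) : (0 < d)%N -> 0 <= e ->
  0 < V -> 0 < j1 -> 0 < j2 -> j1 * Num.sqrt (d.+2%:R / 2) <= j2 ->
  2 * j1 * V = P -> Num.sqrt pi * (2 * j2 * B) = P * (e / 2) ->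
  A = B + d.+2%:R^-1 * A -> A <= e / Num.sqrt (2 * pi * d%:R) * V.
Proof.
move=> d_gt0 e0 V0 j10 j20 j12 <- BE AE.
set b := Num.sqrt (d.+2%:R / 2) in j12.
have D0 : 0 < d%:R :> R by rewrite ltr0n.
have t0 : 0 < Num.sqrt (2 * d%:R) :> R by rewrite sqrtr_gt0 mulr_gt0.
have -> : Num.sqrt (2 * pi * d%:R) = Num.sqrt pi * Num.sqrt (2 * d%:R) :> R.
  by rewrite -sqrtrM ?pi_ge0//; congr Num.sqrt; ring.
have d2 : d.+2%:R = d%:R + 2 :> R by rewrite -addn2 natrD.
(* This is [d (d + 2) <= (d + 1)^2] in disguise: the squares of the two sides differ by exactly
   [2 (d + 2)]. *)
have tb : (d%:R + 2) * Num.sqrt (2 * d%:R) <= 2 * (d%:R + 1) * b.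
  have t2 : Num.sqrt (2 * d%:R) ^+ 2 = 2 * d%:R :> R by rewrite sqr_sqrtr// mulr_ge0.
  have b2 : b ^+ 2 = (d%:R + 2) / 2 by rewrite sqr_sqrtr ?d2// divr_ge0// addr_ge0.
  have b0 : 0 <= b by exact: sqrtr_ge0.
  rewrite -ler_sqr ?nnegrE; last 2 first.
  - by rewrite mulr_ge0 ?addr_ge0// ltW.
  - by rewrite !mulr_ge0 ?addr_ge0.
  rewrite !exprMn t2 b2 -subr_ge0.
  rewrite (_ : _ - _ = 2 * (d%:R + 2)); first by rewrite mulr_ge0 ?addr_ge0.
  by field.
have {AE} -> : A = (d%:R + 2) / (d%:R + 1) * B.
  have dd : d%:R + 2 != 0 :> R by rewrite gt_eqF// addr_gt0.
  have : (d%:R + 2) * A = (d%:R + 2) * B + A.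
    by rewrite {1}AE d2 mulrDr mulVKf.
  move=> H; have : (d%:R + 1) * A = (d%:R + 2) * B by lra.
  by move=> H1; apply: (mulfI (_ : d%:R + 1 != 0)); [rewrite gt_eqF// addr_gt0|
    rewrite H1; field; rewrite gt_eqF// addr_gt0].
have q0 := sqrtpi_gt0; move: (Num.sqrt pi) q0 BE => q q0 BE.
have {BE} -> : B = j1 * V * e / (2 * q * j2).
  apply: (mulfI (_ : 2 * q * j2 != 0)); first by rewrite gt_eqF// !mulr_gt0.
  rewrite (_ : 2 * q * j2 * B = q * (2 * j2 * B)); last by ring.
  rewrite BE.
  by field; rewrite !gt_eqF.
move: (Num.sqrt (2 * d%:R)) t0 tb => t t0 tb.
have d1 : 0 < d%:R + 1 :> R by rewrite addr_gt0.
(* With the common factor pulled out, the claim is [(d + 2) t j1 <= 2 (d + 1) j2], which follows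
   from [tb] and [j1 b <= j2]. *)
rewrite (_ : e / (q * t) * V = V * e / (2 * q * (d%:R + 1) * j2 * t) * (2 * (d%:R + 1) * j2)); last first.
  by field; rewrite !gt_eqF.
rewrite (_ : _ / _ * (_ / _) = V * e / (2 * q * (d%:R + 1) * j2 * t) * ((d%:R + 2) * t * j1)); last first.
  by field; rewrite !gt_eqF.
apply: ler_wpM2l.
  by rewrite divr_ge0 ?mulr_ge0// ltW.
apply: (le_trans (ler_wpM2r (ltW j10) tb)).
rewrite -!mulrA ler_pM2l// ler_pM2l// mulrC//.
Qed.

(** The integrand has degree 0, and multiplied by [|y|] it becomes [posdot v], of degree 1. The
    Gaussian computation evaluates the degree 1 integral, and [ball_int_norm] carries the result
    back to degree 0. *)
Lemma ball_int_posdot d (v : d.+1.-tuple R) : (0 < d)%N ->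
  (ball_int (fun y : d.+1.-tuple R => (posdot v y / enorm y)%:E) <=
   (enorm v / Num.sqrt (2 * pi * d%:R))%:E * @ball_int R d.+1 (cst 1%E))%E.
Proof.
move=> d_gt0; pose f (y : d.+1.-tuple R) := (posdot v y / enorm y)%:E; rewrite -/f.
have f0 y : (0 <= f y)%E by rewrite lee_fin divr_ge0 ?posdot_ge0 ?enorm_ge0.
have mf : measurable_fun setT f.
  apply/measurable_EFinP; apply: measurable_funM; first exact: measurable_posdot.
  exact: measurable_enormV.
have fZ r y : 0 < r -> f (tscale r y) = f y.
  move=> r0; rewrite /f posdotZ ?enorm_tscale ?(ltW r0)// invfM mulrACA divff ?mul1r//.
  exact: lt0r_neq0.
have mp : measurable_fun setT (fun y => (posdot v y)%:E).
  by apply/measurable_EFinP; exact: measurable_posdot.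
have p0 y : (0 <= (posdot v y)%:E)%E by rewrite lee_fin posdot_ge0.
have fE : ball_int (fun y => f y * (enorm y)%:E)%E = ball_int (fun y => (posdot v y)%:E).
  apply: eq_integral => y _; congr (_ * _)%E; rewrite -EFinM; congr EFin.
  have [y0|y0] := eqVneq (enorm y) 0; last by rewrite divfK.
  by rewrite y0 mulr0 /posdot enorm_eq0_dotp// maxxx.
(* Needed before [A = B + A / (d + 2)] can be solved for [A]: the equation alone does not exclude an
   infinite [A]. *)
have A_fin : ball_int f \is a fin_num.
  rewrite ge0_fin_numE ?ball_int_ge0//.
  apply: (@le_lt_trans _ _ (((dotp v v + 1) / 2)%:E * @ball_int R d.+1 (cst 1%E))%E); last first.
    by rewrite -(fineK (ball_int_cst1_fin _)) -EFinM ltry.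
  have vv : 0 <= (dotp v v + 1) / 2 by rewrite divr_ge0// addr_ge0// dotp_ge0.
  have m1 : measurable_fun setT
      (fun y : d.+1.-tuple R => cst 1 y * (enorm y <= 1)%R%:R%:E : \bar R)%E.
    exact: measurable_homog_ball.
  rewrite /ball_int -ge0_integralZl; last 4 first.
  - by [].
  - exact: m1.
  - by move=> y _; apply: mule_ge0; rewrite ?lee_fin.
  - by rewrite lee_fin.
  apply: ge0_le_integral; [by []|..].
  - by move=> y _; apply: mule_ge0; [exact: f0|rewrite lee_fin ler0n].
  - exact: measurable_homog_ball.
  - exact: emeasurable_funM.
  - move=> y _; rewrite /= mul1e -EFinM !lee_fin.
    by apply: ler_wpM2r => //; exact: posdot_norm_le.
have := ball_int_norm mf f0 fZ; rewrite fE => AE.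
have B_fin : ball_int (fun y => (posdot v y)%:E) \is a fin_num.
  rewrite ge0_fin_numE ?ball_int_ge0//.
  apply: (@le_lt_trans _ _ (ball_int f)); last by rewrite -ge0_fin_numE ?ball_int_ge0.
  by rewrite [leRHS]AE leeDl// mule_ge0 ?ball_int_ge0.
move: AE.
have := integral_posdot_gaussn v.
rewrite (@integral_homog_gaussn R d.+1 1)//; last first.
  by move=> r y r0; rewrite posdotZ ?ltW// EFinM.
have := ball_int_cst1 d.+1.
have := @half_moment_ratio R d.+1; have := half_moment_gt0 d.+1.
have := half_moment_gt0 d.+2; have := ball_int_cst1_gt0 d.+1.
rewrite addn1 -(fineK A_fin) -(fineK B_fin).
rewrite -(fineK (half_moment_fin d.+2)) -(fineK (half_moment_fin d.+3)).
rewrite -(fineK (ball_int_cst1_fin d.+1)) -!EFinM -EFinD lee_fin /=.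
move=> V0 j20 j10 j12 [VE] [BE] [AE].
exact: ball_int_posdot_arith d_gt0 (enorm_ge0 v) V0 j10 j20 j12 VE BE AE.
Qed.

End HalfspaceMean.

(** * The surface measure *)

Lemma ge0_integral_mrestr d (T : measurableType d) (R : realType)
    (mu : {measure set T -> \bar R}) (D : set T) (mD : measurable D) (f : T -> \bar R) :
  measurable_fun setT f -> (forall x, (0 <= f x)%E) ->
  (\int[mrestr mu mD]_x f x = \int[mu]_(x in D) f x)%E.
Proof.
move=> mf f0.
rewrite -(setUv D) ge0_integral_setU//; last 3 first.
- exact: measurableC.
- by rewrite setUv.
- exact/disj_setPCl.
rewrite [X in (_ + X)%E](_ : _ = 0%E) ?adde0; last first.
  rewrite (eq_measure_integral mzero) ?integral_measure_zero// => A mA AD.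
  by rewrite /= /mrestr (_ : A `&` D = set0) ?measure0//; apply/disjoints_subset.
apply: eq_measure_integral => A mA AD.
by rewrite /= /mrestr setIidl.
Qed.

Section SurfaceMeasure.
Context {R : realType} (d : nat).
Local Notation T := (d.+1.-tuple R).

Definition normalize (y : T) : T := tscale (enorm y)^-1 y.

Lemma measurable_normalize : measurable_fun setT normalize.
Proof. by apply: measurable_tscale => //; exact: measurable_enormV. Qed.

Lemma enorm_normalize y : enorm y != 0 -> enorm (normalize y) = 1.
Proof. by move=> y0; rewrite enorm_tscale ?invr_ge0 ?enorm_ge0// mulVf. Qed.

Lemma measurable_in_cone : measurable_fun setT (@in_cone R d.+1).
Proof.
by apply: measurable_and; [apply: measurable_fun_ltr|apply: measurable_fun_ler] => //;
  exact: measurable_enorm.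
Qed.

Definition cone : set T := [set y | in_cone y].

Lemma measurable_cone : measurable cone.
Proof.
rewrite (_ : cone = setT `&` in_cone (n := d.+1) @^-1` [set true]).
  exact: measurable_in_cone.
by rewrite setTI.
Qed.

Let V : R := fine (@ball_int R d.+1 (cst 1%E)).
Let V0 : 0 < V := ball_int_cst1_gt0 d.+1.
Let Vi0 : 0 <= V^-1. Proof. by rewrite invr_ge0 ltW. Qed.

Lemma ball_volE : ball_vol R d.+1 = V%:E.
Proof.
rewrite /V fineK ?ball_int_cst1_fin// /ball_vol IntRnE.
- by apply: eq_integral => y _; rewrite mul1e.
- apply/measurable_EFinP; apply: measurable_natb; apply: measurable_fun_ler => //.
  exact: measurable_enorm.
- by move=> y; rewrite lee_fin.
Qed.

(** The measure behind [sph_int]: Lebesgue measure restricted to the punctured ball, pushed forward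
    along [normalize] and divided by the volume of the ball. It lives on all of [R^(d+1)] and gives
    mass 0 to the complement of the sphere. *)
Definition surface : set T -> \bar R :=
  mscale (NngNum Vi0) (mimage (mrestr (mtuple d.+1) measurable_cone) measurable_normalize).

HB.instance Definition _ := Measure.on surface.

Lemma ge0_integral_surface (f : T -> \bar R) :
  measurable_fun setT f -> (forall x, (0 <= f x)%E) ->
  (\int[surface]_x f x = (V^-1)%:E * \int[mtuple d.+1]_(y in cone) f (normalize y))%E.
Proof.
move=> mf f0; rewrite /surface ge0_integral_mscale; [|by []|exact: mf|by []].
congr (_ * _)%E; rewrite (ge0_integral_mimage _ _ mf f0) ge0_integral_mrestr.
- by [].
- by apply: measurableT_comp => //; exact: measurable_normalize.
- by move=> y; exact: f0.
Qed.

Lemma sph_intE (f : T -> \bar R) :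
  measurable_fun setT f -> (forall x, (0 <= f x)%E) ->
  sph_int f = (\int[surface]_x f x)%E.
Proof.
move=> mf f0; rewrite ge0_integral_surface// /sph_int ball_volE; congr (_ * _)%E.
rewrite integral_mkcond IntRnE.
- apply: eq_integral => y _; rewrite patchE.
  by have -> : (y \in cone) = in_cone y by apply/idP/idP => [/set_mem|/mem_set].
- apply: measurable_fun_ifT.
  + exact: measurable_in_cone.
  + by apply: measurableT_comp => //; exact: measurable_normalize.
  + exact: measurable_cst.
- by move=> y; case: ifP.
Qed.

Let enorm0 (y : T) : \bar R := (enorm y == 0)%:R%:E.

Let measurable_enorm0 : measurable_fun setT enorm0.
Proof.
apply/measurable_EFinP; apply: measurable_natb; apply: measurable_fun_eqr => //.
exact: measurable_enorm.
Qed.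

Let enorm0_ge0 y : (0 <= enorm0 y)%E. Proof. by rewrite lee_fin. Qed.

(* The origin is invariant under dilations. *)
Lemma integral_enorm0 : (\int[mtuple d.+1]_y enorm0 y = 0)%E.
Proof.
have I0 : (0 <= \int[mtuple d.+1]_y enorm0 y)%E by exact: integral_ge0.
have Ifin : (\int[mtuple d.+1]_y enorm0 y <= @ball_int R d.+1 (cst 1))%E.
  apply: ge0_le_integral => //.
  - exact: measurable_homog_ball.
  - move=> y _; rewrite mul1e lee_fin ler_nat /enorm0.
    by case: eqVneq => // ->; rewrite ler01.
have : (\int[mtuple d.+1]_y enorm0 y =
    (2 ^+ d.+1)%:E * \int[mtuple d.+1]_y enorm0 y)%E.
  have two0 : (2 : R) != 0 by [].
  rewrite {1}(ge0_integral_tscale two0 measurable_enorm0 enorm0_ge0) ger0_norm//.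
  congr (_ * _)%E; apply: eq_integral => y _.
  by rewrite /enorm0 enorm_tscale// mulf_eq0 (negPf two0).
have := @ball_int_cst1_fin R d.+1; rewrite ge0_fin_numE; last exact: le_trans Ifin.
move=> /(le_lt_trans Ifin).
case: (integral _ _ _) I0 => // x; rewrite lee_fin => x0 _ [H]; congr EFin.
(* A finite value equal to [2 ^+ d.+1] times itself is zero. Finiteness came from comparison with
   the volume of the unit ball, which contains the origin. *)
have : 1 < 2 ^+ d.+1 :> R by rewrite exprn_egt1// ltr1n.
by nra.
Qed.

Lemma surface_setT : surface setT = 1%E.
Proof.
transitivity (\int[surface]_x cst 1%E x)%E; first by rewrite integral_cst// mul1e.
rewrite ge0_integral_surface//.
have -> : (\int[mtuple d.+1]_(y in cone) cst 1%E (normalize y) = V%:E)%E; last first.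
  by rewrite -EFinM mulVf// gt_eqF.
(* The cone is the closed ball without the origin; adding the null mass of the origin completes
   it. *)
rewrite /V fineK ?ball_int_cst1_fin// -[LHS]adde0 -integral_enorm0.
rewrite integral_mkcond -ge0_integralD; last 5 first.
- by [].
- by move=> y _; rewrite patchE; case: ifP.
- apply/(measurable_restrictT _ measurable_cone);
  apply: measurable_funTS; exact: (@measurable_cst _ _ _ _ setT (1%E : \bar R)).
- by [].
- exact: measurable_enorm0.
apply: eq_integral => y _; rewrite patchE mul1e.
have -> : (y \in cone) = in_cone y by apply/idP/idP => [/set_mem|/mem_set].
rewrite /in_cone /enorm0 lt_neqAle enorm_ge0 eq_sym andbT.
by case: eqVneq => [->|_] /=; [rewrite ler01 add0e|case: ifP; rewrite adde0].
Qed.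

HB.instance Definition _ := Measure_isProbability.Build _ _ _ surface surface_setT.

(** Since [normalize] sends the cone into the sphere, a comparison on the sphere suffices. This
    allows integrands whose formula is meaningful only for unit vectors. *)
Lemma surface_le (f g : T -> \bar R) :
  measurable_fun setT f -> (forall x, (0 <= f x)%E) ->
  measurable_fun setT g -> (forall x, (0 <= g x)%E) ->
  (forall x, enorm x = 1 -> (f x <= g x)%E) ->
  (\int[surface]_x f x <= \int[surface]_x g x)%E.
Proof.
move=> mf f0 mg g0 fg; rewrite !ge0_integral_surface//.
apply: lee_wpmul2l; first by rewrite lee_fin.
apply: ge0_le_integral => //.
- exact: measurable_cone.
- by apply: measurable_funTS; apply: measurableT_comp => //; exact: measurable_normalize.
- by apply: measurable_funTS; apply: measurableT_comp => //; exact: measurable_normalize.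
- by move=> y /andP[y0 _]; apply: fg; rewrite enorm_normalize// gt_eqF.
Qed.

Lemma surface_eq (f g : T -> \bar R) :
  measurable_fun setT f -> (forall x, (0 <= f x)%E) ->
  measurable_fun setT g -> (forall x, (0 <= g x)%E) ->
  (forall x, enorm x = 1 -> f x = g x) ->
  (\int[surface]_x f x = \int[surface]_x g x)%E.
Proof.
by move=> mf f0 mg g0 fg; apply/le_anti/andP; split; apply: surface_le => // x /fg ->.
Qed.

End SurfaceMeasure.

(** * Null sets, antipodal symmetry and linear averages on the sphere *)

Section SurfaceProperties.
Context {R : realType} (d : nat).
Local Notation T := (d.+1.-tuple R).
Local Notation sigma := (@surface R d).

Lemma measurable_restrict_cone (f : T -> \bar R) : measurable_fun setT f ->
  measurable_fun setT ((fun y => f (normalize y)) \_ (@cone R d)).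
Proof.
move=> mf; apply/(measurable_restrictT _ (@measurable_cone R d)).
apply: measurable_funTS; apply: measurableT_comp => //; exact: measurable_normalize.
Qed.

Lemma measurable_sphere : measurable (@sphere R d).
Proof.
have mE : measurable_fun setT (fun x : T => enorm x == 1).
  by apply: measurable_fun_eqr => //; exact: measurable_enorm.
rewrite (_ : @sphere R d = setT `&` (fun x : T => enorm x == 1) @^-1` [set true]).
  exact: mE.
by rewrite setTI; apply/seteqP; split => x /eqP.
Qed.

Lemma surface_sphereC : sigma (~` @sphere R d) = 0%E.
Proof.
have mS : measurable (~` @sphere R d) by apply: measurableC; exact: measurable_sphere.
have mI : measurable_fun setT (fun x : T => (\1_(~` @sphere R d) x)%:E : \bar R).
  by apply/measurable_EFinP; exact: measurable_indic.
rewrite -[X in sigma X]setIT -integral_indic//.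
transitivity (\int[sigma]_x cst 0%E x)%E; last by rewrite integral0.
apply: surface_eq => // x x1.
by rewrite indicE memNset// => /(_ x1).
Qed.

Lemma surface_posdot (v : T) : (0 < d)%N ->
  (\int[sigma]_x (posdot v x)%:E <= (enorm v / Num.sqrt (2 * pi * d%:R))%:E)%E.
Proof.
move=> d0; rewrite ge0_integral_surface; last 2 first.
- by apply/measurable_EFinP; exact: measurable_posdot.
- by move=> x; rewrite lee_fin posdot_ge0.
have V0 := @ball_int_cst1_gt0 R d.+1.
rewrite lee_pdivrMl//; apply: (le_trans _ (le_trans (ball_int_posdot v d0) _)); last first.
  by rewrite fineK ?ball_int_cst1_fin// muleC.
rewrite integral_mkcond; apply: ge0_le_integral => //.
- by move=> y _; rewrite patchE; case: ifP => // _; rewrite lee_fin posdot_ge0.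
- apply: (measurable_restrict_cone (f := fun y => (posdot v y)%:E)).
  by apply/measurable_EFinP; exact: measurable_posdot.
- apply: emeasurable_funM.
    apply/measurable_EFinP; apply: measurable_funM; first exact: measurable_posdot.
    exact: measurable_enormV.
  by apply/measurable_EFinP; apply: measurable_natb; apply: measurable_fun_ler => //;
    exact: measurable_enorm.
- move=> y _; rewrite patchE -EFinM; case: ifPn => [/set_mem/andP[_ ->]|_].
    by rewrite mulr1 posdotZ ?invr_ge0 ?enorm_ge0// mulrC.
  by rewrite lee_fin mulr_ge0// divr_ge0 ?posdot_ge0 ?enorm_ge0.
Qed.

(* The hyperplane [dotp w y = 0] has Gaussian measure zero, hence Lebesgue
   measure zero in the ball, being invariant under dilations. *)
Lemma surface_hyperplane (w : T) : enorm w != 0 ->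
  (\int[sigma]_x (dotp w x == 0)%R%:R%:E = 0)%E.
Proof.
move=> w0; pose h (s : R) : \bar R := (s == 0)%:R%:E.
have mh : measurable_fun setT h.
  by apply/measurable_EFinP; apply: measurable_natb; exact: measurable_fun_eqr.
have h0 s : (0 <= h s)%E by rewrite lee_fin.
have mhd : measurable_fun setT (fun y : T => h (dotp w y)).
  by apply: measurableT_comp => //; exact: measurable_dotp.
have := @integral_gaussn_dotp R d.+1 w h mh h0.
rewrite [X in (_ * X)%E = _](@integral_homog_gaussn R d.+1 0 _ mhd) //; last first.
  move=> r y r0; rewrite expr0 mul1e /h dotpC dotp_tscale mulf_eq0 dotpC.
  by rewrite gt_eqF.
have -> : (\int[lebesgue_measure]_s (h (enorm w * s)%R * (gauss_fun s)%:E) = 0)%E.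
  transitivity (\int[lebesgue_measure]_(s in [set (0 : R)%R]) (gauss_fun s)%:E)%E.
    rewrite [RHS]integral_mkcond; apply: eq_integral => s _.
    rewrite patchE /h mulf_eq0 (negPf w0)/=.
    have -> : (s \in [set (0 : R)%R]) = (s == 0).
      by apply/idP/eqP => [/set_mem|/mem_set].
    by case: eqP => _; rewrite ?mul1e// mul0e.
  by rewrite integral_set1.
rewrite mule0 addn0 => H.
have B0 : ball_int (fun y : T => h (dotp w y)) = 0%E.
  apply/eqP; move/eqP: H; rewrite !mule_eq0 !eqe gt_eqF ?sqrtr_gt0 ?pi_gt0//=.
  rewrite pnatr_eq0/= -(fineK (half_moment_fin d.+2)) eqe gt_eqF//.
  exact: half_moment_gt0.
rewrite ge0_integral_surface//.
suff -> : (\int[mtuple d.+1]_(y in (@cone R d)) (dotp w (normalize y) == 0)%R%:R%:E = 0 :> \bar R)%E.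
  by rewrite mule0.
apply/le_anti/andP; split; last exact: integral_ge0.
rewrite -B0 integral_mkcond; apply: ge0_le_integral => //.
- by move=> y _; rewrite patchE; case: ifP => // _; rewrite lee_fin.
- exact: measurable_restrict_cone mhd.
- apply: emeasurable_funM => //.
  by apply/measurable_EFinP; apply: measurable_natb; apply: measurable_fun_ler => //;
    exact: measurable_enorm.
- move=> y _; rewrite patchE; case: ifPn => [/set_mem/andP[y0 ->]|_].
    rewrite mule1 /h dotpC dotp_tscale mulf_eq0 dotpC.
    by rewrite invr_eq0 gt_eqF.
  by rewrite mule_ge0 ?lee_fin.
Qed.

(** A quarter turn in the plane of the first two coordinates, which exist because [d >= 1]. If both
    coordinates of [x] vanish there, the first basis vector serves. *)
Lemma exists_orthogonal (x : T) : (0 < d)%N ->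
  exists w : T, enorm w != 0 /\ dotp w x = 0.
Proof.
case: d x => // k x _; case: (tupleP x) => a x1; case: (tupleP x1) => b z.
pose o : k.-tuple R := [tuple 0 | i < k].
have o0 y : dotp o y = 0.
  by apply: big1 => i _; rewrite tnth_mktuple mul0r.
have [/andP[/eqP-> /eqP->]|ab] := boolP ((a == 0) && (b == 0)).
  exists (cons_tuple 1 (cons_tuple 0 o)); rewrite -sqrf_eq0 sqr_enorm.
  by rewrite !dotp_cons !o0 !mulr0 !addr0 mulr1 oner_eq0.
exists (cons_tuple (- b) (cons_tuple a o)); rewrite -sqrf_eq0 sqr_enorm.
rewrite !dotp_cons !o0 !addr0; split; last by ring.
by rewrite mulrNN paddr_eq0 -?expr2 ?sqr_ge0// !sqrf_eq0 andbC.
Qed.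

(** A point lies on some hyperplane through the origin, and those are null. For [d = 0] it would
    fail: each of the two points of the sphere has mass [1/2]. *)
Lemma surface_set1 (x : T) : (0 < d)%N -> measurable [set x] -> sigma [set x] = 0%E.
Proof.
move=> d0 mx; have [w [w0 wx]] := exists_orthogonal x d0.
have mI : measurable_fun setT (fun y : T => (\1_[set x] y)%:E : \bar R).
  by apply/measurable_EFinP; exact: measurable_indic.
apply/le_anti/andP; split; last exact: measure_ge0.
rewrite -(surface_hyperplane w0).
have -> : sigma [set x] = (\int[sigma]_y (\1_[set x] y)%:E)%E.
  by rewrite integral_indic// setIT.
apply: surface_le => //.
- apply/measurable_EFinP; apply: measurable_natb; apply: measurable_fun_eqr => //.
  exact: measurable_dotp.
- move=> y _; rewrite lee_fin indicE; have [/set_mem->|_] := boolP (y \in [set x]).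
    by rewrite wx eqxx.
  by rewrite ler0n.
Qed.

Lemma surfaceN (f : T -> \bar R) :
  measurable_fun setT f -> (forall x, (0 <= f x)%E) ->
  (\int[sigma]_x f (tscale (-1) x) = \int[sigma]_x f x)%E.
Proof.
move=> mf f0.
have mN : measurable_fun setT (fun x : T => tscale (-1) x) by exact: measurable_tscale.
have mfN : measurable_fun setT (fun x => f (tscale (-1) x)) by exact: measurableT_comp.
suff E : (\int[mtuple d.+1]_(y in @cone R d) f (tscale (-1) (normalize y)) =
    \int[mtuple d.+1]_(y in @cone R d) f (normalize y))%E.
  by rewrite (ge0_integral_surface mf f0) (ge0_integral_surface mfN (fun=> f0 _)) E.
rewrite integral_mkcond [RHS]integral_mkcond.
have N1 : (-1 : R) != 0 by rewrite oppr_eq0 oner_eq0.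
rewrite [RHS](ge0_integral_tscale N1); last 2 first.
- exact: measurable_restrict_cone.
- by move=> y; rewrite patchE; case: ifP.
rewrite normrN1 expr1n mul1e; apply: eq_integral => y _; rewrite !patchE.
have nN : enorm (tscale (-1) y) = enorm y.
  by rewrite /enorm dotp_tscale dotpC dotp_tscale !mulN1r opprK.
have -> : (tscale (-1) y \in (@cone R d)) = (y \in (@cone R d)).
  have nC : in_cone (tscale (-1) y) = in_cone y by rewrite /in_cone nN.
  by apply/idP/idP => /set_mem H; apply/mem_set; move: H; rewrite /cone/= nC.
case: ifP => // _; congr f; apply: eq_from_tnth => i.
by rewrite /normalize nN !tnth_map mulrAC.
Qed.

Lemma dotp_le1 (x y : T) : enorm x = 1 -> enorm y = 1 -> dotp x y <= 1.
Proof. by move=> x1 y1; have := dotp_le x y; rewrite -!sqr_enorm x1 y1; lra. Qed.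

Lemma dotp_geN1 (x y : T) : enorm x = 1 -> enorm y = 1 -> - 1 <= dotp x y.
Proof.
move=> x1 y1; have := dotp_le (tscale (-1) x) y.
by rewrite !dotp_tscale [dotp x (tscale _ _)]dotpC dotp_tscale -!sqr_enorm x1 y1; lra.
Qed.

(* The truncation at [0] is void on the sphere; it makes the integrand nonnegative
   everywhere. *)
Definition dotp1 (x y : T) : R := Num.max (1 + dotp x y) 0.

Lemma dotp1_ge0 x y : (0 <= (dotp1 x y)%:E)%E.
Proof. by rewrite lee_fin le_max lexx orbT. Qed.

Lemma measurable_dotp1 d' (T' : measurableType d') (f g : T' -> T) :
  measurable_fun setT f -> measurable_fun setT g ->
  measurable_fun setT (fun x => (dotp1 (f x) (g x))%:E).
Proof.
move=> mf mg; apply/measurable_EFinP; apply: measurable_maxr => //.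
by apply: measurable_funD => //; exact: measurable_dotp.
Qed.

Lemma dotp1E (x y : T) : enorm x = 1 -> enorm y = 1 -> dotp1 x y = 1 + dotp x y.
Proof. by move=> x1 y1; rewrite /dotp1 max_l//; have := dotp_geN1 x1 y1; lra. Qed.

(** On the sphere the values at [y] and at its antipode add up to 2, and both have the same integral
    by [surfaceN]. This avoids integrating the signed function [<x, y>]. *)
Lemma integral_dotp1 (x : T) : enorm x = 1 ->
  (\int[sigma]_y (dotp1 x y)%:E = 1)%E.
Proof.
move=> x1; have m1 := measurable_dotp1 (measurable_cst x) (@measurable_id _ T setT).
have mN : measurable_fun setT (fun x : T => tscale (-1) x) by exact: measurable_tscale.
have m2 := measurable_dotp1 (measurable_cst x) mN.
have : (\int[sigma]_y ((dotp1 x y)%:E + (dotp1 x (tscale (-1) y))%:E) = 2%:E)%E.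
  transitivity (\int[sigma]_x cst 2%:E x)%E; last first.
    by rewrite integral_cst// [X in (_ * X)%E](probability_setT sigma) mule1.
  apply: surface_eq.
  - exact: emeasurable_funD.
  - by move=> y; apply: adde_ge0; exact: dotp1_ge0.
  - exact: measurable_cst.
  - by move=> y; rewrite lee_fin.
  - move=> y y1; rewrite !dotp1E//.
      by rewrite -EFinD [dotp x (tscale _ _)]dotpC dotp_tscale dotpC; congr EFin; ring.
    by rewrite /enorm dotp_tscale dotpC dotp_tscale !mulN1r opprK.
rewrite ge0_integralD//; try by move=> y _; exact: dotp1_ge0.
rewrite (surfaceN m1 (dotp1_ge0 x)).
have : (0 <= \int[sigma]_y (dotp1 x y)%:E)%E.
  by apply: integral_ge0 => y _; exact: dotp1_ge0.
by case: (integral _ _ _) => // z _ [H]; congr EFin; lra.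
Qed.

End SurfaceProperties.

(** * Choosing the points *)

(** Were [g > a] everywhere off [N], the excess [max (g - a) 0] would have integral 0 and vanish
    almost everywhere, so that the whole space would be null. *)
Lemma exists_le_mean d (T : measurableType d) (R : realType) (P : probability T R)
    (g : T -> \bar R) (N : set T) (a : R) :
  measurable_fun setT g -> (forall x, (0 <= g x)%E) -> P N = 0%E -> measurable N ->
  (\int[P]_x g x <= a%:E)%E -> exists x, ~ N x /\ (g x <= a%:E)%E.
Proof.
move=> mg g0 N0 mN ga; apply: contrapT => H.
have gt_a x : ~ N x -> (a%:E < g x)%E.
  move=> Nx; rewrite ltNge; apply/negP => gx; apply: H; by exists x.
have a0 : 0 <= a by rewrite -lee_fin (le_trans _ ga)// integral_ge0.
pose f x := maxe (g x - a%:E)%E 0%E.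
have mf : measurable_fun setT f.
  apply: measurable_maxe => //; apply: emeasurable_funB => //; exact: measurable_cst.
have f0 x : (0 <= f x)%E by rewrite /f le_max lexx orbT.
have E : (\int[P]_x (a%:E + f x) = \int[P]_x g x)%E.
  apply: ge0_ae_eq_integral => //.
  - by apply: emeasurable_funD => //; exact: measurable_cst.
  - by move=> x _; rewrite adde_ge0 ?lee_fin.
  - exists N; split => // x /= Hx; apply: contrapT => Nx; apply: Hx => _.
    rewrite /f max_l; last by rewrite sube_ge0 ?fin_numE// ltW// gt_a.
    by rewrite addeC subeK.
have : (\int[P]_x `|f x| = 0)%E.
  move: E ga; rewrite ge0_integralD//.
  rewrite integral_cst// [X in (_ * X)%E](probability_setT P) mule1 => <-.
  have -> : (\int[P]_x `|f x| = \int[P]_x f x)%E.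
    by apply: eq_integral => x _; rewrite gee0_abs.
  have : (0 <= \int[P]_x f x)%E by exact: integral_ge0.
  case: (integral _ _ _) => // x; rewrite lee_fin => x0; rewrite -EFinD lee_fin => xa.
  by congr EFin; lra.
move/(ae_eq_integral_abs P measurableT mf) => [N' [mN' N'0 sub]].
have : P (N `|` N') = 0%E.
  by rewrite measureU0.
have -> : N `|` N' = setT.
  rewrite -subTset => x _; have [Nx|Nx] := pselect (N x); [by left|right].
  apply: sub => /= /(_ I) fx0; have := gt_a _ Nx.
  by rewrite -sube_gt0 ltNge; move: fx0; rewrite /f => <-; rewrite le_max lexx.
by rewrite probability_setT => /eqP; rewrite onee_eq0.
Qed.

Section GreedySampling.
Context dT dZ (T : measurableType dT) (Z : measurableType dZ) (R : realType).
Variables (P : probability T R) (rho : {sigma_finite_measure set Z -> \bar R}).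
Variable b : Z -> T -> bool.
Hypothesis mb : measurable_fun setT (fun p : Z * T => b p.1 p.2).

(** In the application [z] is a cap, given by its height and centre, and [y] a point that it may
    contain. *)
Definition hit (z : Z) (y : T) : R := (b z y)%:R.

Definition hit_mean (z : Z) : R := fine (\int[P]_y (hit z y)%:E)%E.

Lemma measurable_hit : measurable_fun setT (fun p : Z * T => hit p.1 p.2).
Proof. exact: measurable_natb. Qed.

Lemma hit_ge0 z y : 0 <= hit z y. Proof. exact: ler0n. Qed.

Lemma hit_le1 z y : hit z y <= 1. Proof. by rewrite /hit; case: b. Qed.

Lemma hitE z y : hit z y = 0 \/ hit z y = 1.
Proof. by rewrite /hit; case: b; [right|left]. Qed.

Lemma measurable_hit1 z : measurable_fun setT (hit z).
Proof. exact: measurableT_comp measurable_hit (pair1_measurable z). Qed.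

Lemma integral_hit_miss z :
  (\int[P]_y (hit z y)%:E + \int[P]_y (1 - hit z y)%:E = 1)%E.
Proof.
rewrite -ge0_integralD//.
- under eq_integral do rewrite -EFinD addrC subrK.
  by rewrite integral_cst// mul1e [LHS](probability_setT P).
- by move=> y _; rewrite lee_fin hit_ge0.
- by apply/measurable_EFinP; exact: measurable_hit1.
- by move=> y _; rewrite lee_fin subr_ge0 hit_le1.
- by apply/measurable_EFinP; apply: measurable_funB => //; exact: measurable_hit1.
Qed.

Lemma integral_hit z : (\int[P]_y (hit z y)%:E = (hit_mean z)%:E)%E.
Proof.
rewrite /hit_mean fineK// ge0_fin_numE; last first.
  by apply: integral_ge0 => y _; rewrite lee_fin hit_ge0.
apply: (@le_lt_trans _ _ 1%E); last exact: ltry.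
rewrite -(integral_hit_miss z) leeDl//.
by apply: integral_ge0 => y _; rewrite lee_fin subr_ge0 hit_le1.
Qed.

Lemma integral_miss z : (\int[P]_y (1 - hit z y)%:E = (1 - hit_mean z)%:E)%E.
Proof.
have := integral_hit_miss z; rewrite integral_hit.
by case: (\int[P]_y (1 - hit z y)%:E)%E => // x [<-]; rewrite addrAC subrr add0r.
Qed.

Lemma hit_mean_ge0 z : 0 <= hit_mean z.
Proof.
by rewrite -lee_fin -integral_hit integral_ge0// => y _; rewrite lee_fin hit_ge0.
Qed.

Lemma hit_mean_le1 z : hit_mean z <= 1.
Proof.
rewrite -subr_ge0 -lee_fin -integral_miss integral_ge0// => y _.
by rewrite lee_fin subr_ge0 hit_le1.
Qed.

Lemma measurable_hit_mean : measurable_fun setT hit_mean.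
Proof.
apply/measurable_EFinP; rewrite (_ : EFin \o _ = fun z => \int[P]_y (hit z y)%:E)%E.
  apply: measurable_ge0_integral; last by move=> z y; rewrite lee_fin hit_ge0.
  by apply/measurable_EFinP; exact: measurable_hit.
by apply/funext => z; rewrite /= integral_hit.
Qed.

(* The variance of a Bernoulli variable of parameter [hit_mean z]. *)
Lemma integral_sqr_hit z (D : R) :
  (\int[P]_y ((D + (hit z y - hit_mean z)) ^+ 2)%:E =
   (D ^+ 2 + hit_mean z * (1 - hit_mean z))%:E)%E.
Proof.
set V := hit_mean z.
(* As [hit] takes only the values 0 and 1, the square is a combination of [hit] and [1 - hit] with
   nonnegative coefficients; no signed cross term has to be integrated. *)
transitivity (\int[P]_y (((D + (1 - V)) ^+ 2)%:E * (hit z y)%:E +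
   ((D - V) ^+ 2)%:E * (1 - hit z y)%:E))%E.
  apply: eq_integral => y _; rewrite -!EFinM -EFinD; congr EFin.
  by case: (hitE z y) => ->; ring.
have m1 : measurable_fun setT (fun y => (hit z y)%:E).
  by apply/measurable_EFinP; exact: measurable_hit1.
have m2 : measurable_fun setT (fun y => (1 - hit z y)%:E).
  by apply/measurable_EFinP; apply: measurable_funB => //; exact: measurable_hit1.
have p1 y : (0 <= (hit z y)%:E)%E by rewrite lee_fin hit_ge0.
have p2 y : (0 <= (1 - hit z y)%:E)%E by rewrite lee_fin subr_ge0 hit_le1.
rewrite ge0_integralD//; last 4 first.
- by move=> y _; rewrite mule_ge0 ?lee_fin ?sqr_ge0 ?hit_ge0.
- exact: emeasurable_funM.
- by move=> y _; rewrite mule_ge0 ?lee_fin ?sqr_ge0 ?subr_ge0 ?hit_le1.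
- exact: emeasurable_funM.
rewrite ge0_integralZl//; last by rewrite lee_fin sqr_ge0.
rewrite ge0_integralZl//; last by rewrite lee_fin sqr_ge0.
by rewrite integral_hit integral_miss -/V -!EFinM -EFinD; congr EFin; ring.
Qed.

(** Not divided by the number of points, so that a new point adds one term and leaves the others
    unchanged. *)
Definition local_disc (s : seq T) (z : Z) : R := \sum_(y <- s) (hit z y - hit_mean z).

Lemma measurable_local_disc s : measurable_fun setT (local_disc s).
Proof.
apply: measurable_sum => y; apply: measurable_funB; last exact: measurable_hit_mean.
exact: measurableT_comp measurable_hit (pair2_measurable y).
Qed.

(* Averaging over the next point adds exactly the variance term, since the cross
   term has mean zero; so some next point, outside a given null set, adds at most
   that. *)
Lemma greedy_points (S : set T) (c : R) (N : nat) :
  (forall y : T, measurable [set y] /\ P [set y] = 0%E) ->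
  measurable S -> P (~` S) = 0%E ->
  (\int[rho]_z (hit_mean z * (1 - hit_mean z))%:E <= c%:E)%E ->
  exists s : seq T, [/\ size s = N, uniq s, {in s, forall y, S y} &
    (\int[rho]_z ((local_disc s z) ^+ 2)%:E <= (N%:R * c)%:E)%E].
Proof.
move=> atomless mS S1 var_le.
have mv : measurable_fun setT (fun z => (hit_mean z * (1 - hit_mean z))%:E).
  apply/measurable_EFinP; apply: measurable_funM; first exact: measurable_hit_mean.
  by apply: measurable_funB => //; exact: measurable_hit_mean.
have v0 z : (0 <= (hit_mean z * (1 - hit_mean z))%:E)%E.
  by rewrite lee_fin mulr_ge0 ?hit_mean_ge0// subr_ge0 hit_mean_le1.
elim: N => [|N [s [sN us sS IH]]].
  exists [::]; split => //.
  rewrite mul0r integral0_eq// => z _.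
  by rewrite /local_disc big_nil expr0n.
pose G y := (\int[rho]_z ((local_disc s z + (hit z y - hit_mean z)) ^+ 2)%:E)%E.
pose F z y := (((local_disc s z + (hit z y - hit_mean z)) ^+ 2)%:E : \bar R).
have mF : measurable_fun setT (fun p : Z * T => F p.1 p.2).
  apply/measurable_EFinP; apply: measurable_funX; apply: measurable_funD.
    by apply: measurableT_comp => //; exact: measurable_local_disc.
  apply: measurable_funB; first exact: measurable_hit.
  by apply: measurableT_comp => //; exact: measurable_hit_mean.
have mF' : measurable_fun setT (fun p : T * Z => F p.2 p.1).
  exact: measurableT_comp mF (@measurable_swap _ _ _ _).
have F0 z y : (0 <= F z y)%E by rewrite lee_fin sqr_ge0.
have GE : (\int[P]_y G y <= (N.+1%:R * c)%:E)%E.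
  rewrite [X in (X <= _)%E](@tonelli _ _ _ _ _ P rho (fun y z => F z y))//.
  rewrite (eq_integral (fun z => ((local_disc s z) ^+ 2)%:E +
     (hit_mean z * (1 - hit_mean z))%:E)%E); last first.
    by move=> z _; rewrite integral_sqr_hit -EFinD.
  rewrite ge0_integralD//; last 2 first.
  - by move=> z _; rewrite lee_fin sqr_ge0.
  - by apply/measurable_EFinP; apply: measurable_funX; exact: measurable_local_disc.
  by rewrite -natr1 mulrDl mul1r EFinD leeD.
have mG : measurable_fun setT G.
  by apply: measurable_ge0_integral; [exact: mF'|move=> y z; exact: F0].
have G0 y : (0 <= G y)%E by apply: integral_ge0 => z _; exact: F0.
(* The forbidden null set: everything outside [S], and the points already chosen, which keeps the
   sequence duplicate-free. *)
pose Nl := ~` S `|` \big[setU/set0]_(y <- s) [set y].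
have mNl : measurable Nl.
  apply: measurableU; first exact: measurableC.
  by apply: bigsetU_measurable => y _; case: (atomless y).
have Nl0 : P Nl = 0%E.
  have mbig (r : seq T) : measurable (\big[setU/set0]_(y <- r) [set y]).
    by apply: bigsetU_measurable => y _; case: (atomless y).
  rewrite /Nl measureU0//; first exact: measurableC.
  elim: (s) => [|y r IHr]; first by rewrite big_nil measure0.
  rewrite big_cons measureU0//; first by case: (atomless y).
  by case: (atomless y).
have [y [yN Gy]] := exists_le_mean mG G0 Nl0 mNl GE.
exists (y :: s); split => /=.
- by rewrite sN.
- rewrite us andbT; apply/negP => ys; apply: yN; right.
  by rewrite -bigcup_seq; exists y.
- move=> x; rewrite inE => /predU1P[->|/sS//].
  by apply: contrapT => Sy; apply: yN; left.
apply: le_trans Gy; rewrite /G le_eqVlt; apply/orP; left; apply/eqP.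
by apply: eq_integral => z _; rewrite /local_disc big_cons addrC.
Qed.

End GreedySampling.

(** * Spherical caps *)

Section CapDiscrepancy.
Context {R : realType} (d : nat).
Hypothesis d_gt0 : (0 < d)%N.
Local Notation T := (d.+1.-tuple R).
Local Notation leb := (@lebesgue_measure R).
Local Notation sigma := (@surface R d : probability T R).
Local Notation Z := (measurableTypeR R * T)%type.
Local Notation rho := (sfprod leb (@surface R d)).

Lemma measurable_set1_tuple (y : T) : measurable [set y].
Proof.
have mE : measurable_fun setT (fun x : T => enorm (tsub x y) == 0).
  by apply: measurable_fun_eqr => //; apply: measurable_enorm; exact: measurable_tsub.
rewrite (_ : [set y] = setT `&` (fun x : T => enorm (tsub x y) == 0) @^-1` [set true]).
  exact: mE.
rewrite setTI; apply/seteqP; split => x /=.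
  move=> ->; rewrite -sqrf_eq0 sqr_enorm_tsub; apply/eqP; ring.
rewrite -sqrf_eq0 sqr_enorm psumr_eq0 => [/allP xy|i _]; last by rewrite -expr2 sqr_ge0.
apply: eq_from_tnth => i; have := xy i (mem_index_enum i).
by rewrite /= mulf_eq0 orbb tnth_mktuple subr_eq0 => /eqP.
Qed.

(** The height range is part of the test. Outside it nothing is hit and the mean is 0, so the
    integral over heights in [[-1, 1]] becomes one over the whole product space [rho]. *)
Definition in_cap (z : Z) (y : T) : bool := (-1 <= z.1 <= 1) && (z.1 <= dotp z.2 y).

Lemma measurable_in_cap d' (T' : measurableType d') (t : T' -> R) (x y : T' -> T) :
  measurable_fun setT t -> measurable_fun setT x -> measurable_fun setT y ->
  measurable_fun setT (fun p => in_cap (t p, x p) (y p)).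
Proof.
move=> mt mx my; apply: measurable_and; first apply: measurable_and;
  by apply: measurable_fun_ler => //; exact: measurable_dotp.
Qed.

Lemma measurable_in_cap2 : measurable_fun setT (fun p : Z * T => in_cap p.1 p.2).
Proof.
rewrite (_ : (fun p => _) = (fun p : Z * T => in_cap (p.1.1, p.1.2) p.2)); last first.
  by apply/funext => -[[]].
by apply: measurable_in_cap => //; apply: measurableT_comp.
Qed.

Local Notation capm := (hit_mean sigma in_cap).

Lemma cap_meanE (t : R) (x : T) : -1 <= t <= 1 -> capm (t, x) = sigma_cap x t.
Proof.
move=> t1; rewrite /sigma_cap sph_intE.
- by congr fine; apply: eq_integral => y _; rewrite /hit /in_cap t1.
- apply/measurable_EFinP; apply: measurable_natb; apply: measurable_fun_ler => //.
  exact: measurable_dotp.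
- by move=> y; rewrite lee_fin.
Qed.

Lemma cap_mean_out (t : R) (x : T) : ~~ (-1 <= t <= 1) -> capm (t, x) = 0.
Proof.
move=> /negPf t1; rewrite /hit_mean integral0_eq// => y _.
by rewrite /hit /in_cap t1.
Qed.

Lemma integral_slab (f : R -> T -> \bar R) (g : Z -> \bar R) :
  measurable_fun setT g -> (forall z, (0 <= g z)%E) ->
  (forall t x, -1 <= t <= 1 -> f t x = g (t, x)) ->
  (forall t x, ~~ (-1 <= t <= 1) -> g (t, x) = 0%E) ->
  (\int[leb]_(t in `[(-1)%R, 1%R]%classic) sph_int (f t) = \int[rho]_z g z)%E.
Proof.
move=> mg g0 fg gout; rewrite ge0_integral_sfprod// integral_mkcond.
apply: eq_integral => t _; rewrite patchE.
have -> : (t \in `[(-1)%R, 1%R]%classic) = (-1 <= t <= 1).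
  by apply/idP/idP => [/set_mem|? ]; [rewrite /= in_itv|apply/mem_set; rewrite /= in_itv].
case: ifPn => t1; last by rewrite integral0_eq// => x _; rewrite gout.
rewrite -sph_intE.
- by congr sph_int; apply/funext => x; rewrite fg.
- exact: measurableT_comp mg (pair1_measurable _).
- by move=> x; exact: g0.
Qed.

(** The heights of the caps around [x] that contain [y] fill the interval [[-1, <x, y>]], of length
    [1 + <x, y>]. *)
Lemma integral_in_cap (x y : T) : enorm x = 1 -> enorm y = 1 ->
  (\int[leb]_t (hit R in_cap (t, x) y)%:E = (dotp1 x y)%:E)%E.
Proof.
move=> x1 y1; rewrite dotp1E//.
transitivity (\int[leb]_t (1 * (hit R in_cap (t, x) y))%:E)%E.
  by apply: eq_integral => t _; rewrite mul1r.
rewrite (@integral_indicb R (fun t => in_cap (t, x) y) `[-1, dotp x y]%classic (fun=> 1))//.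
  rewrite integral_cst// mul1e [LHS]lebesgue_measure_itv/= lte_fin.
  have := dotp_geN1 x1 y1; rewrite le_eqVlt => /predU1P[<-|->].
    by rewrite ltxx subrr.
  by rewrite -EFinB opprK addrC.
apply/seteqP; split => t /=; rewrite in_itv/= /in_cap/=.
  by move=> /andP[-> t1]; rewrite t1 andbT/= (le_trans t1)// dotp_le1.
by move=> /andP[/andP[-> _] ->].
Qed.

Lemma hitE0 (z : Z) y : (0 <= (hit R in_cap z y)%:E :> \bar R)%E.
Proof. by rewrite lee_fin hit_ge0. Qed.

Lemma measurable_capm : measurable_fun setT (fun z => (capm z)%:E).
Proof. by apply/measurable_EFinP; apply: measurable_hit_mean; exact: measurable_in_cap2. Qed.

(** With the height integrated first, the integrand becomes [1 + <x, y>], whose mean over [y] is 1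
    by antipodal symmetry. *)
Lemma integral_cap_mean : (\int[rho]_z (capm z)%:E = 1)%E.
Proof.
have mh := measurable_in_cap2.
rewrite ge0_integral_sfprod; last 2 first.
- exact: measurable_capm.
- by move=> z; rewrite lee_fin hit_mean_ge0.
transitivity (\int[leb]_t \int[sigma]_x \int[sigma]_y (hit R in_cap (t, x) y)%:E)%E.
  by apply: eq_integral => t _; apply: eq_integral => x _; rewrite integral_hit.
have m3 : measurable_fun setT (fun p : (R * T) * T => (hit R in_cap p.1 p.2)%:E : \bar R).
  by apply/measurable_EFinP; exact: measurable_natb mh.
rewrite (@tonelli _ _ _ _ _ leb sigma
    (fun t x => \int[sigma]_y (hit R in_cap (t, x) y)%:E)%E); last 2 first.
- rewrite (_ : (fun p => _) =
      (fun p : R * T => \int[sigma]_y (hit R in_cap p y)%:E)%E); last first.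
    by apply/funext => -[].
  by apply: measurable_ge0_integral => // z y; exact: hitE0.
- by move=> t x; apply: integral_ge0 => y _; exact: hitE0.
transitivity (\int[sigma]_x \int[sigma]_y \int[leb]_t (hit R in_cap (t, x) y)%:E)%E.
  apply: eq_integral => x _.
  apply: (@tonelli _ _ _ _ _ leb sigma (fun t y => (hit R in_cap (t, x) y)%:E)).
    by apply/measurable_EFinP; apply: measurable_natb; exact: measurable_in_cap.
  by move=> t y; exact: hitE0.
have my (x : T) : measurable_fun setT
    (fun y : T => \int[leb]_t (hit R in_cap (t, x) y)%:E)%E.
  apply: measurable_ge0_integral => [|y t]; last exact: hitE0.
  by apply/measurable_EFinP; apply: measurable_natb; exact: measurable_in_cap.
have mxy : measurable_fun setT
    (fun p : T * T => \int[leb]_t (hit R in_cap (t, p.1) p.2)%:E)%E.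
  apply: measurable_ge0_integral => [|p t]; last exact: hitE0.
  apply/measurable_EFinP; apply: measurable_natb.
  by apply: measurable_in_cap => //; apply: measurableT_comp.
have i0 x y : (0 <= \int[leb]_t (hit R in_cap (t, x) y)%:E)%E.
  by apply: integral_ge0 => t _; exact: hitE0.
transitivity (\int[sigma]_x cst 1%E x)%E; last first.
  by rewrite integral_cst// mul1e [LHS](probability_setT sigma).
apply: surface_eq.
- by apply: measurable_ge0_integral; [exact: mxy|exact: i0].
- by move=> x; apply: integral_ge0 => y _; exact: i0.
- exact: measurable_cst.
- by move=> x; rewrite lee_fin.
move=> x x1.
rewrite [RHS](_ : _ = \int[sigma]_y (dotp1 x y)%:E)%E; last by rewrite integral_dotp1.
apply: surface_eq.
- exact: my.
- exact: i0.
- exact: measurable_dotp1.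
- exact: dotp1_ge0.
- by move=> y y1; exact: integral_in_cap.
Qed.

(** Jensen's inequality in tangent form: [a <= (a^2 + 2) / (2 sqrt 2)] for [a = |y - w|]. On the
    sphere [a^2 = 2 - 2 <y, w>], so the right side is affine in [<y, w>] and has mean [sqrt 2]. *)
Lemma integral_enorm_tsub (y : T) : enorm y = 1 ->
  (\int[sigma]_w (enorm (tsub y w))%:E <= (Num.sqrt 2)%:E)%E.
Proof.
move=> y1; set q : R := Num.sqrt 2.
have q0 : 0 < q by rewrite sqrtr_gt0.
have qq : q * q = 2 by rewrite -expr2 sqr_sqrtr.
have mN : measurable_fun setT (fun x : T => tscale (-1) x) by exact: measurable_tscale.
have m1 : measurable_fun setT (fun w : T => (dotp1 y (tscale (-1) w))%:E).
  exact: measurable_dotp1.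
have md := measurable_dotp1 (measurable_cst y) (@measurable_id _ T setT).
have i1 : (\int[sigma]_w ((q / 2)%:E * (1 + (dotp1 y (tscale (-1) w))%:E)) = q%:E)%E.
  rewrite ge0_integralZl; last 4 first.
  - by [].
  - by apply: emeasurable_funD; [exact: measurable_cst|exact: m1].
  - by move=> w _; apply: adde_ge0; [exact: lee01|exact: dotp1_ge0].
  - by rewrite lee_fin divr_ge0// ltW.
  rewrite ge0_integralD; last 5 first.
  - by [].
  - by move=> w _; exact: lee01.
  - exact: measurable_cst.
  - by move=> w _; exact: dotp1_ge0.
  - exact: m1.
  rewrite (surfaceN md (dotp1_ge0 y)) integral_dotp1// integral_cst//.
  by rewrite [X in (1 * X)%E](probability_setT sigma) mul1e -EFinD -EFinM divfK.
rewrite -i1; apply: surface_le.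
- by apply/measurable_EFinP; apply: measurable_enorm; exact: measurable_tsub.
- by move=> w; rewrite lee_fin enorm_ge0.
- apply: emeasurable_funM; first exact: measurable_cst.
  by apply: emeasurable_funD => //; exact: measurable_cst.
- move=> w; apply: mule_ge0; first by rewrite lee_fin divr_ge0// ltW.
  by apply: adde_ge0; [exact: lee01|exact: dotp1_ge0].
- move=> w w1; rewrite dotp1E//; last first.
    by rewrite /enorm dotp_tscale dotpC dotp_tscale !mulN1r opprK.
  rewrite -EFinD -EFinM lee_fin [dotp y (tscale _ _)]dotpC dotp_tscale [dotp w y]dotpC.
  have := sqr_enorm_tsub y w; rewrite -!sqr_enorm y1 w1.
  have := sqr_ge0 (enorm (tsub y w) - q).
  move: (enorm (tsub y w)) (dotp y w) => a b' H1 H2.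
  rewrite -(ler_pM2l q0) (_ : q * (q / 2 * _) = (q * q) / 2 * (1 + (1 + -1 * b'))); last by ring.
  by rewrite qq; nra.
Qed.

(** A cap around [x] contains [y] but not [w] only for heights in []<x, w>, <x, y>]]. The
    restriction to [[-1, 1]] is dropped, hence an inequality, valid also off the sphere. *)
Lemma integral_cap_split (x y w : T) :
  (\int[leb]_t ((hit R in_cap (t, x) y)%:E * (1 - hit R in_cap (t, x) w)%:E) <=
   (posdot (tsub y w) x)%:E)%E.
Proof.
set a := dotp x w; set b := dotp x y.
have E : (\int[leb]_t (1 * ((a < t) && (t <= b))%R%:R)%:E = (posdot (tsub y w) x)%:E)%E.
  rewrite (@integral_indicb R (fun t => (a < t) && (t <= b)) `]a, b]%classic (fun=> 1))//.
  rewrite integral_cst// mul1e [LHS]lebesgue_measure_itv/= lte_fin.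
  rewrite /posdot dotp_tsub [dotp y x]dotpC [dotp w x]dotpC -/a -/b.
  by case: ltP => ab; rewrite -?EFinB; [rewrite max_l// subr_ge0 ltW|
     rewrite max_r// subr_le0].
rewrite -E; apply: ge0_le_integral => //.
- by move=> t _; rewrite mule_ge0 ?lee_fin ?hit_ge0 ?subr_ge0 ?hit_le1.
- apply/measurable_EFinP; apply: measurable_funM.
    by apply: measurable_natb; exact: measurable_in_cap.
  by apply: measurable_funB => //; apply: measurable_natb; exact: measurable_in_cap.
- apply/measurable_EFinP; apply: measurable_funM => //; apply: measurable_natb.
  by apply: measurable_and; [apply: measurable_fun_ltr|apply: measurable_fun_ler].
- move=> t _; rewrite -EFinM lee_fin mul1r /hit /in_cap /= -/a -/b.
  rewrite [a < t]ltNge; move: (-1 <= t) (t <= 1) (t <= b) (t <= a) => b1 b2 b3 b4.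
  by case: b1 b2 b3 b4 => [] [] [] [] /=;
    rewrite ?(mul0r, subrr, mulr0, subr0, mulr1) ?lexx ?ler01.
Qed.

(** For a fixed cap, [V (1 - V)] is the probability that an independent pair [y], [w] has [y] inside
    and [w] outside. Moving the integral over caps inside turns it into the mean of a positive part,
    linear in the centre of the cap. *)
Lemma cap_variance_le :
  (\int[rho]_z (capm z * (1 - capm z))%:E <= ((Num.sqrt (pi * d%:R))^-1)%:E)%E.
Proof.
have mb := measurable_in_cap2.
pose H (z : Z) (y w : T) : \bar R :=
  ((hit R in_cap z y)%:E * (1 - hit R in_cap z w)%:E)%E.
have H0 z y w : (0 <= H z y w)%E.
  by apply: mule_ge0; rewrite lee_fin ?hit_ge0// subr_ge0 hit_le1.
have mH d' (T' : measurableType d') (t : T' -> R) (x y w : T' -> T) :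
    measurable_fun setT t -> measurable_fun setT x ->
    measurable_fun setT y -> measurable_fun setT w ->
    measurable_fun setT (fun p => H (t p, x p) (y p) (w p)).
  move=> mt mx my mw; apply/measurable_EFinP; apply: measurable_funM.
    by apply: measurable_natb; exact: measurable_in_cap.
  by apply: measurable_funB => //; apply: measurable_natb; exact: measurable_in_cap.
have mHz d' (T' : measurableType d') (z : T' -> Z) (y w : T' -> T) :
    measurable_fun setT z -> measurable_fun setT y -> measurable_fun setT w ->
    measurable_fun setT (fun p => H (z p) (y p) (w p)).
  move=> mz my mw; rewrite (_ : (fun p => _) =
    (fun p => H ((z p).1, (z p).2) (y p) (w p))); last first.
    by apply/funext => p; case: (z p).
  by apply: mH => //; apply: measurableT_comp => //.
have -> : (\int[rho]_z (capm z * (1 - capm z))%:E =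
    \int[rho]_z \int[sigma]_y \int[sigma]_w H z y w)%E.
  apply: eq_integral => z _; rewrite EFinM -(integral_hit _ mb) -ge0_integralZr; last 4 first.
  - by [].
  - by apply/measurable_EFinP; exact: measurable_hit1.
  - by move=> y _; exact: hitE0.
  - by rewrite lee_fin subr_ge0 hit_mean_le1.
  apply: eq_integral => y _; rewrite -(integral_miss _ mb) -ge0_integralZl; last 4 first.
  - by [].
  - by apply/measurable_EFinP; apply: measurable_funB => //; exact: measurable_hit1.
  - by move=> w _; rewrite lee_fin subr_ge0 hit_le1.
  - exact: hitE0.
  by [].
rewrite (@tonelli _ _ _ _ _ rho sigma (fun z y => \int[sigma]_w H z y w)%E); last 2 first.
- apply: measurable_ge0_integral => [|p w]; last exact: H0.
  by apply: mHz => //; apply: measurableT_comp.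
- by move=> z y; apply: integral_ge0 => w _; exact: H0.
pose k : R := Num.sqrt (2 * pi * d%:R).
(* With [y] and [w] fixed, the height is integrated first and the centre second; [surface_posdot]
   accepts the vector [y - w], which need not be a unit vector. *)
have inner y w : (\int[rho]_z H z y w <= (enorm (tsub y w) / k)%:E)%E.
  rewrite ge0_integral_sfprod; last 2 first.
  - by apply: mHz.
  - by move=> z; exact: H0.
  rewrite (@tonelli _ _ _ _ _ leb sigma (fun t x => H (t, x) y w)); last 2 first.
  - exact: mH.
  - by move=> t x; exact: H0.
  apply: le_trans (surface_posdot (tsub y w) d_gt0).
  apply: ge0_le_integral => //.
  - by move=> x _; apply: integral_ge0 => t _; exact: H0.
  - apply: measurable_ge0_integral => [|x t]; last exact: H0.
    exact: mH.
  - by apply/measurable_EFinP; exact: measurable_posdot.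
  - by move=> x _; exact: integral_cap_split.
have k0 : 0 < k by rewrite sqrtr_gt0 !mulr_gt0 ?pi_gt0 ?ltr0n.
have q0 : 0 < Num.sqrt 2 :> R by rewrite sqrtr_gt0.
have -> : (Num.sqrt (pi * d%:R))^-1 = Num.sqrt 2 / k.
  have -> : k = Num.sqrt 2 * Num.sqrt (pi * d%:R) by rewrite /k -mulrA sqrtrM.
  by rewrite invfM mulrA divff ?mul1r// gt_eqF.
have mzw y : measurable_fun setT (fun p : Z * T => H p.1 y p.2) by exact: mHz.
apply: (@le_trans _ _ (\int[sigma]_y cst (Num.sqrt 2 / k)%:E y)%E); last first.
  by rewrite integral_cst// [X in (_ * X)%E](probability_setT sigma) mule1.
apply: surface_le.
- apply: measurable_ge0_integral => [|y z]; last first.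
    by apply: integral_ge0 => w _; exact: H0.
  apply: measurable_ge0_integral => [|p w]; last exact: H0.
  by apply: mHz => //; apply: measurableT_comp.
- by move=> y; apply: integral_ge0 => z _; apply: integral_ge0 => w _; exact: H0.
- exact: measurable_cst.
- by move=> y; rewrite lee_fin divr_ge0// ltW.
move=> y y1.
rewrite (@tonelli _ _ _ _ _ rho sigma (fun z w => H z y w)); last 2 first.
- exact: mzw.
- by move=> z w; exact: H0.
apply: (@le_trans _ _ (\int[sigma]_w ((k^-1)%:E * (enorm (tsub y w))%:E))%E).
  apply: ge0_le_integral => //.
  - by move=> w _; apply: integral_ge0 => z _; exact: H0.
  - apply: measurable_ge0_integral => [|w z]; last exact: H0.
    by apply: mHz.
  - apply: emeasurable_funM => //; apply/measurable_EFinP; apply: measurable_enorm.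
    exact: measurable_tsub.
  - by move=> w _; rewrite -EFinM mulrC; exact: inner.
rewrite ge0_integralZl; last 4 first.
- by [].
- by apply/measurable_EFinP; apply: measurable_enorm; exact: measurable_tsub.
- by move=> w _; rewrite lee_fin enorm_ge0.
- by rewrite lee_fin invr_ge0 ltW.
rewrite mulrC EFinM; apply: lee_wpmul2l; first by rewrite lee_fin invr_ge0 ltW.
exact: integral_enorm_tsub.
Qed.

Lemma integral_sqr_cap_mean :
  (\int[rho]_z (capm z ^+ 2)%:E + \int[rho]_z (capm z * (1 - capm z))%:E = 1)%E.
Proof.
have m : measurable_fun setT capm by apply/measurable_EFinP; exact: measurable_capm.
rewrite -ge0_integralD; last 5 first.
- by [].
- by move=> z _; rewrite lee_fin sqr_ge0.
- by apply/measurable_EFinP; exact: measurable_funX.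
- move=> z _; rewrite lee_fin; have mb := measurable_in_cap2.
  by apply: mulr_ge0; [exact: hit_mean_ge0|rewrite subr_ge0; exact: hit_mean_le1].
- apply/measurable_EFinP; apply: measurable_funM => //.
  exact: measurable_funB.
rewrite -integral_cap_mean; apply: eq_integral => z _.
by rewrite -EFinD; congr EFin; ring.
Qed.

Lemma L2cap_initE :
  L2cap_init R d = Num.sqrt (fine (\int[rho]_z (capm z ^+ 2)%:E)%E).
Proof.
congr (Num.sqrt (fine _)); apply: integral_slab.
- apply/measurable_EFinP; apply: measurable_funX; apply/measurable_EFinP.
  exact: measurable_capm.
- by move=> z; rewrite lee_fin sqr_ge0.
- by move=> t x t1; rewrite cap_meanE.
- by move=> t x t1; rewrite cap_mean_out// expr0n.
Qed.

Lemma L2capE N (P : 'I_N -> T) (s : seq T) : (0 < N)%N -> s = codom P ->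
  L2cap P = Num.sqrt (fine (((N%:R ^- 2)%:E *
    \int[rho]_z (local_disc sigma in_cap s z ^+ 2)%:E)%E)).
Proof.
move=> N0 sE.
have md := measurable_local_disc sigma measurable_in_cap2 s.
rewrite -ge0_integralZl; last 4 first.
- by [].
- by apply/measurable_EFinP; exact: measurable_funX.
- by move=> z _; rewrite lee_fin sqr_ge0.
- by rewrite lee_fin invr_ge0 exprn_ge0.
congr (Num.sqrt (fine _)); apply: integral_slab.
- by apply: emeasurable_funM => //; apply/measurable_EFinP; exact: measurable_funX.
- by move=> z; rewrite -EFinM lee_fin mulr_ge0 ?sqr_ge0// invr_ge0 exprn_ge0.
- move=> t x t1; rewrite -EFinM -exprVn -exprMn; congr (_ ^+ 2)%:E.
  rewrite /local_disc sE big_image/= sumrB mulrBr -(cap_meanE x t1); congr (_ * _ - _).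
    by apply: eq_bigr => i _; rewrite /hit /in_cap t1.
  rewrite sumr_const card_ord -[X in _ = _ * X]mulr_natl mulKf//.
  by rewrite pnatr_eq0 -lt0n.
- move=> t x t1; rewrite (_ : local_disc _ _ _ _ = 0) ?expr0n ?mule0//.
  apply: big1 => y _; rewrite cap_mean_out// subr0.
  by rewrite /hit /in_cap (negPf t1).
Qed.

End CapDiscrepancy.

(** * From the variance bound to the number of points *)

Theorem theorem1 (R : realType) (d : nat) (hd : (1 <= d)%N) (eps : R)
    (heps0 : 0 < eps) (heps1 : eps < 1) :
  (Ncap eps d <=
   ((Num.ceil (eps ^- 2 * (Num.sqrt (pi * d%:R) - 1)^-1))%:~R)%:E)%E.
Proof.
set r := Num.sqrt (pi * d%:R); set X := eps ^- 2 * (r - 1)^-1.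
(* From [pi >= 2] and [d >= 1]; it makes the denominator [r - 1] positive. *)
have r1 : 1 < r.
  have d1 : 1 <= d%:R :> R by rewrite ler1n.
  rewrite -[ltLHS]sqrtr1 ltr_sqrt; have := pi_ge2 R; nra.
have X0 : 0 < X by rewrite mulr_gt0// invr_gt0 ?exprn_gt0// subr_gt0.
have cX0 : 0 < Num.ceil X by rewrite ceil_gt0.
pose N := absz (Num.ceil X).
have NE : (N%:R : R) = (Num.ceil X)%:~R by rewrite -[in RHS](gtz0_abs cX0).
have N0 : (0 < N)%N by rewrite absz_gt0 gt_eqF.
have N0R : 0 < N%:R :> R by rewrite ltr0n.
rewrite -NE; apply: ereal_inf_lbound; exists N => //; split => //.
have mS := @measurable_sphere R d.
have atomless (y : d.+1.-tuple R) : measurable [set y] /\ @surface R d [set y] = 0%E.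
  by split; [|apply: surface_set1 => //]; exact: measurable_set1_tuple.
have [s [sN us sS disc]] := greedy_points (@measurable_in_cap2 R d) N atomless mS
  (@surface_sphereC R d) (cap_variance_le hd).
pose x0 : d.+1.-tuple R := [tuple 0 | i < d.+1].
pose P (i : 'I_N) := nth x0 s i.
have sE : s = codom P.
  rewrite /codom /image_mem -[LHS](mkseq_nth x0) sN /mkseq -val_enum_ord -map_comp.
  by rewrite enumT.
exists P; split; first split.
- move=> i j /eqP; rewrite /P nth_uniq ?sN//.
  by move=> /eqP /val_inj.
- by move=> i; apply/mem_set/sS; rewrite mem_nth// sN.
rewrite (L2capE N0 sE) L2cap_initE//.
have := @integral_sqr_cap_mean R d.
have : (0 <= \int[sfprod lebesgue_measure (@surface R d)]_z
    (hit_mean (@surface R d) (@in_cap R d) z ^+ 2)%:E)%E.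
  by apply: integral_ge0 => z _; rewrite lee_fin sqr_ge0.
have := cap_variance_le (R := R) hd; rewrite -/r.
have : (0 <= \int[sfprod lebesgue_measure (@surface R d)]_z
    (hit_mean (@surface R d) (@in_cap R d) z *
     (1 - hit_mean (@surface R d) (@in_cap R d) z))%:E)%E.
  apply: integral_ge0 => z _; rewrite lee_fin; have mb := @measurable_in_cap2 R d.
  by apply: mulr_ge0; [exact: hit_mean_ge0|rewrite subr_ge0; exact: hit_mean_le1].
move: disc; rewrite -/r.
have : (0 <= \int[sfprod lebesgue_measure (@surface R d)]_z
    (local_disc (@surface R d) (@in_cap R d) s z ^+ 2)%:E)%E.
  by apply: integral_ge0 => z _; rewrite lee_fin sqr_ge0.
(* [D], [v] and [i] are the real values of the integrated squared [local_disc], of the variance term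
   and of the squared initial discrepancy. Infinity is excluded by the upper bounds on the first two
   and by [i + v = 1] for the third. *)
case: (integral _ _ _) => // D; rewrite lee_fin => D0; rewrite lee_fin => DN.
case: (integral _ _ _) => // v; rewrite lee_fin => v0; rewrite lee_fin => vr.
case: (integral _ _ _) => // i; rewrite lee_fin => i0 [iv].
rewrite -EFinM /=.
have -> : eps * Num.sqrt i = Num.sqrt (eps ^+ 2 * i).
  by rewrite sqrtrM ?sqr_ge0// sqrtr_sqr gtr0_norm.
apply: ler_wsqrtr.
have r0 : 0 < r by exact: lt_trans r1.
have XN : X <= N%:R by rewrite NE ceil_ge.
(* The equation that determines [X]: with [1 / r] in the role of [c], it says
   [c / X = eps^2 (1 - c)]. *)
have E : r^-1 = X * eps ^+ 2 * (1 - r^-1).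
  by rewrite /X; field; rewrite !gt_eqF// subr_gt0.
have ri1 : 0 <= 1 - r^-1 by rewrite subr_ge0 invf_le1// ltW.
(* The chain is [D / N^2 <= 1 / (N r) <= eps^2 (1 - 1 / r) <= eps^2 i]; the middle step uses
   [X <= N], the last one [i = 1 - v] and [v <= 1 / r]. *)
apply: (@le_trans _ _ (N%:R^-1 * r^-1)).
  apply: (@le_trans _ _ (N%:R ^- 2 * (N%:R * r^-1))).
    by apply: ler_wpM2l => //; rewrite invr_ge0 exprn_ge0.
  by rewrite expr2 invfM -!mulrA mulKf// gt_eqF.
rewrite ler_pdivrMl// E -mulrA mulrCA.
apply: (@le_trans _ _ (N%:R * (eps ^+ 2 * (1 - r^-1)))).
  by rewrite mulrCA; apply: ler_wpM2r => //; rewrite mulr_ge0// sqr_ge0.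
apply: ler_wpM2l => //; apply: ler_wpM2l; first exact: sqr_ge0.
by lra.
Qed.
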